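(* Let $\mathcal{H}$, $\mathcal{W}_h$, $T:\mathcal{H}\to\mathcal{H}$, $T_h:\mathcal{W}_h\to\mathcal{W}_h$ ($0<h\le 1$) and their eigenvalues $\mu_k$, $\mu_{h,k}$ be as defined in the context, and suppose that the following four conditions are satisfied. I. There exist continuous linear operators $R_h:\mathcal{H}\to\mathcal{W}_h$ such that $\Vert R_hu\Vert_{a,\omega^\ast}\le c_0\Vert u\Vert_{a,\omega^\ast}$ for all $u\in\mathcal{H}$, with $c_0$ independent of $h$; moreover $\lim_{h\to0}a_{\omega^\ast}(u_h,v_h)=a_{\omega^\ast}(u,v)$ whenever $u_h,v_h\in\mathcal{W}_h$, $u,v\in\mathcal{H}$ satisfy $\lim_{h\to0}\Vert u_h-R_hu\Vert_{a,\omega^\ast}=0$ and $\lim_{h\to0}\Vert v_h-R_hv\Vert_{a,\omega^\ast}=0$. II. The operators $T_h$, $T$ are positive, compact and self-adjoint, and the norms $\Vert T_h\Vert_{\mathcal{L}(\mathcal{W}_h)}$ are bounded by a constant independent of $h$. III. If $\psi_h\in\mathcal{W}_h$, $\psi\in\mathcal{H}$ and $\lim_{h\to0}\Vert\psi_h-R_h\psi\Vert_{a,\omega^\ast}=0$, then $\lim_{h\to0}\Vert T_h\psi_h-R_hT\psi\Vert_{a,\omega^\ast}=0$. IV. For any sequence $\psi_h\in\mathcal{W}_h$ with $\sup_{h\in(0,1]}\Vert\psi_h\Vert_{a,\omega^\ast}<\infty$, there exist a subsequence $\psi_{h'}$ and a function $u\in\mathcal{H}$ such that $\Vert T_{h'}\psi_{h'}-R_{h'}u\Vert_{a,\omega^\ast}\to0$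 as $h'\to0$. Then $$\mu_{h,k}\to\mu_k\quad\text{as }h\to0,\qquad k=1,2,\cdots.$$ Moreover, for each $k=1,2,\cdots$ and for sufficiently small $h$, $$|\mu_{h,k}-\mu_k|\le 2\sup_{u\in N(\mu_k,T),\ \Vert u\Vert_{a,\omega^\ast}=1}\Vert T_hR_hu-R_hTu\Vert_{a,\omega^\ast},$$ where $N(\mu_k,T)=\{u\in\mathcal{H}:Tu=\mu_ku\}$ is the eigenspace of $T$ for the eigenvalue $\mu_k$.
   Context: $\Omega\subset\mathbb{R}^d$, $d=2,3$, is a bounded polygonal/polyhedral Lipschitz domain with $\partial\Omega_D\cap\partial\Omega_N=\emptyset$, $\overline{\partial\Omega_D}\cup\overline{\partial\Omega_N}=\partial\Omega$. $A\in(L^\infty(\Omega))^{d\times d}$ is pointwise symmetric with $\alpha|\xi|^2\le A(x)\xi\cdot\xi\le\beta|\xi|^2$ ($0<\alpha<\beta$). For a subdomain $D$, $a_D(u,v)=\int_DA\nabla u\cdot\nabla v\,dx$, $\Vert u\Vert_{a,D}=\sqrt{a_D(u,u)}$. $\tau_h$ are shape-regular triangulations of $\Omega$ (triangles/tetrahedra, or rectangles if $\Omega$ is rectangular) with mesh size $h$, and $V_h\subset H^1(\Omega)$ the lowest-order Lagrange finite element spaces. $\omega\subset\omega^\ast\subset\Omega$ are open subdomains, $\omega^\ast$ resolved by the meshes. $\chi$ is the partition of unity function supported on $\omega$: $0\le\chi\le1$, $\chi=0$ on $\Omega\setminus\omega$, $\chi\in C^1(\omega)$, $|\nabla\chi|\le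 C_1/\mathrm{diam}(\omega)$. Spaces: $H^1_D(\omega^\ast)=\{v\in H^1(\omega^\ast):v=0\text{ on }\partial\omega^\ast\cap\partial\Omega_D\}$; $H^1_{DI}(\omega^\ast)=\{v\in H^1(\omega^\ast):v=0\text{ on }(\partial\omega^\ast\cap\partial\Omega_D)\cup(\partial\omega^\ast\cap\Omega)\}$; $H_{A,D}(\omega^\ast)=\{u\in H^1_D(\omega^\ast):a_{\omega^\ast}(u,v)=0\ \forall v\in H^1_{DI}(\omega^\ast)\}$. $V_h(\omega^\ast)$ consists of the restrictions of functions of $V_h$ to $\omega^\ast$; $V_{h,D}(\omega^\ast)$ and $V_{h,DI}(\omega^\ast)$ are the subspaces of $V_h(\omega^\ast)$ of functions vanishing on $\partial\omega^\ast\cap\partial\Omega_D$, respectively on $(\partial\omega^\ast\cap\partial\Omega_D)\cup(\partial\omega^\ast\cap\Omega)$; $W_h(\omega^\ast)=\{u\in V_{h,D}(\omega^\ast):a_{\omega^\ast}(u,v)=0\ \forall v\in V_{h,DI}(\omega^\ast)\}$. With $\mathcal{M}_\omega(u)=\int_\omega A\nabla(\chi u)\cdot\nabla\chi\,dx$: - if $\partial\omega^\ast\cap\partial\Omega_D\ne\emptyset$, put $\mathcal{H}=H_{A,D}(\omega^\ast)$, $\mathcal{W}_h=W_h(\omega^\ast)$; - if $\partial\omega^\ast\cap\partial\Omega_D=\emptyset$, put $\mathcal{H}=\{u\in H_{A,D}(\omega^\ast):\mathcal{M}_\omega(u)=0\}$, $\mathcal{W}_h=\{u\in W_h(\omega^\ast):\mathcal{M}_\omega(u)=0\}$.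 Both are equipped with the inner product $a_{\omega^\ast}(\cdot,\cdot)$. Operators: $T:\mathcal{H}\to\mathcal{H}$ is defined by $a_{\omega^\ast}(Tu,v)=a_\omega(\chi u,\chi v)$ for all $v\in\mathcal{H}$; $T_h:\mathcal{W}_h\to\mathcal{W}_h$ is defined by $a_{\omega^\ast}(T_hu,v)=a_\omega(\chi u,\chi v)$ for all $v\in\mathcal{W}_h$. In the expressions of the conditions, $T_h$ acts on functions of $\mathcal{W}_h$. The eigenvalues $\mu_1\ge\mu_2\ge\cdots>0$ of $T$ and $\mu_{h,1}\ge\mu_{h,2}\ge\cdots>0$ of $T_h$ are enumerated in nonascending order, repeated according to multiplicity. *)

(* Defs.v *)
From HB Require Import structures.
From mathcomp Require Export all_boot all_order all_algebra.
From mathcomp Require Export all_classical all_reals all_analysis.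
Export Order.TTheory GRing.Theory Num.Theory.
Export numFieldNormedType.Exports.

Set Implicit Arguments.
Unset Strict Implicit.
Unset Printing Implicit Defensive.

Local Open Scope classical_set_scope.
Local Open Scope ring_scope.

Section borel_rV.
Variables (R : realType) (n : nat).

Definition coord (i : 'I_n) (x : 'rV[R]_n) : R := x ord0 i.

Let coord_set0 : g_sigma_preimage coord set0.
Proof. exact: sigma_algebra0. Qed.

Let coord_setC A : g_sigma_preimage coord A -> g_sigma_preimage coord (~` A).
Proof. exact: sigma_algebraC. Qed.

Let coord_bigcup (F : (set 'rV[R]_n)^nat) :
  (forall i, g_sigma_preimage coord (F i)) ->
  g_sigma_preimage coord (\bigcup_i (F i)).
Proof. exact: sigma_algebra_bigcup. Qed.

HB.instance Definition _ := @isMeasurable.Build default_measure_display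
  'rV[R]_n (g_sigma_preimage coord) coord_set0 coord_setC coord_bigcup.

End borel_rV.

Section lebesgue_rV.
Variable R : realType.

Lemma measurable_coordP d1 (T1 : measurableType d1) n (f : T1 -> 'rV[R]_n) :
  (forall i, measurable_fun setT (fun x => f x ord0 i)) ->
  measurable_fun setT f.
Proof.
move=> mf.
suff pS : g_sigma_preimage (fun i => @coord R n i \o f) `<=` measurable.
  move=> _ A mA; rewrite setTI; apply: pS.
  by rewrite g_sigma_preimage_comp; exists A => //; rewrite setTI.
apply: smallest_sub; first exact: sigma_algebra_measurable.
case: n => [|n] in f mf *; first by rewrite big_ord0.
rewrite -bigcup_mkord_ord; apply: bigcup_sub => i Ii.
by move=> A [B mB <-]; exact: mf.
Qed.

Lemma measurable_coord n i : measurable_fun setT (@coord R n i).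
Proof.
move=> _ Y mY; rewrite setTI; apply: sub_sigma_algebra => /=.
rewrite -bigcup_seq/=; exists i => /=; first by rewrite mem_index_enum.
by exists Y => //; rewrite setTI.
Qed.

Definition rV_snoc n (p : 'rV[R]_n * R) : 'rV[R]_n.+1 :=
  \row_i if unlift ord_max i is Some j then p.1 ord0 j else p.2.

Lemma measurable_rV_snoc n : measurable_fun setT (@rV_snoc n).
Proof.
apply: measurable_coordP => i.
under eq_fun do rewrite mxE.
case: (unlift ord_max i) => [j|]; last exact: measurable_snd.
exact: (measurableT_comp (@measurable_coord n j) measurable_fst).
Qed.

Definition leb_snoc n (m : {measure set 'rV[R]_n -> \bar R}) :
    {measure set 'rV[R]_n.+1 -> \bar R} :=
  measure_function_pushforward__canonical__measure_function_Measure
    (m \x lebesgue_measure)%E (@measurable_rV_snoc n).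

(* n-fold product of the one-dimensional Lebesgue measure *)
Fixpoint leb n : {measure set 'rV[R]_n -> \bar R} :=
  if n is n'.+1 then leb_snoc (leb n') else dirac (0 : 'rV[R]_0).

End lebesgue_rV.

Section geometry.
Variables (R : realType) (d : nat).
Implicit Types (x y : 'rV[R]_d) (D : set 'rV[R]_d).

Definition dotp x y : R := \sum_i x ord0 i * y ord0 i.

(* The library norm on 'rV[R]_d is the maximum norm. *)
Definition norm2 x : R := Num.sqrt (dotp x x).

Definition diam D : R :=
  sup [set r | exists x y, [/\ D x, D y & r = norm2 (x - y)]].

Definition bdry D : set 'rV[R]_d := closure D `\` interior D.

Definition subdomain D := [/\ open D, connected D & D !=set0].

(* near each boundary point, D is the region above the graph of a Lipschitz
   function over the hyperplane orthogonal to some unit vector e *)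
Definition lipschitz_boundary D := forall x, bdry D x ->
  exists (e : 'rV[R]_d) (r L : R) (gamma : 'rV[R]_d -> R),
    [/\ norm2 e = 1, 0 < r,
        forall y z, `|gamma y - gamma z| <= L * norm2 (y - z) &
        forall y, norm2 (y - x) < r ->
          (D y <-> gamma (y - x - dotp (y - x) e *: e) < dotp (y - x) e)].

(* Cells: the pair (p, M) encodes the image of the reference cell under
   t |-> p + t *m M, the rows of M being the edges issuing from the vertex p. *)
Definition cell := ('rV[R]_d * 'M[R]_d)%type.

Inductive cell_kind := Simplicial | Rectangular.

Definition ref_cell (k : cell_kind) : set 'rV[R]_d :=
  match k with
  | Simplicial => [set t | (forall i, 0 <= t ord0 i) /\ \sum_i t ord0 i <= 1]
  | Rectangular => [set t | forall i, 0 <= t ord0 i <= 1]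
  end.

Definition cell_map (K : cell) (t : 'rV[R]_d) : 'rV[R]_d := K.1 + t *m K.2.

Definition cell_set k (K : cell) : set 'rV[R]_d := cell_map K @` ref_cell k.

(* nondegenerate; the edges of a rectangular cell are mutually orthogonal *)
Definition cell_ok k (K : cell) : Prop :=
  K.2 \in unitmx /\ (k = Rectangular -> is_diag_mx (K.2 *m K.2^T)).

(* For F and C convex this says that F is a (possibly empty) face of C. *)
Definition face_of (F C : set 'rV[R]_d) := F `<=` C /\
  forall x y (t : R), C x -> C y -> 0 < t < 1 ->
    F (t *: x + (1 - t) *: y) -> F x /\ F y.

Definition cells_cover k (s : seq cell) D :=
  D = [set x | exists2 K, K \in s & cell_set k K x].

Definition polyhedral D := exists s : seq cell,
  (forall K, K \in s -> cell_ok Simplicial K) /\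
  cells_cover Simplicial s (closure D).

Definition rectangular D :=
  exists2 K : cell, cell_ok Rectangular K & D = interior (cell_set Rectangular K).

Definition triangulation k (tau : seq cell) D :=
  [/\ forall K, K \in tau -> cell_ok k K,
      cells_cover k tau (closure D) &
      forall K K', K \in tau -> K' \in tau -> cell_set k K <> cell_set k K' ->
        face_of (cell_set k K `&` cell_set k K') (cell_set k K)].

(* each cell contains a ball of radius comparable to its diameter *)
Definition shape_regular k (sigma : R) (tau : seq cell) :=
  forall K, K \in tau -> exists x r,
    [/\ 0 < r, [set y | norm2 (y - x) < r] `<=` cell_set k K &
        diam (cell_set k K) <= sigma * r].

Definition resolved_by k (tau : seq cell) D :=
  exists s : seq cell, {subset s <= tau} /\ cells_cover k s (closure D).

(* affine functions, resp. polynomials of degree at most 1 in each variable *)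
Definition ref_polynomial k (p : 'rV[R]_d -> R) :=
  exists c : {set 'I_d} -> R,
    (k = Simplicial -> forall S : {set 'I_d}, (1 < #|S|)%N -> c S = 0) /\
    forall t, p t = \sum_(S : {set 'I_d}) c S * \prod_(i in S) t ord0 i.

(* Lowest-order Lagrange space; only the values on closure D are meaningful. *)
Definition lagrange_space k (tau : seq cell) D : set ('rV[R]_d -> R) :=
  [set v | {within closure D, continuous v} /\
     forall K, K \in tau -> exists2 p, ref_polynomial k p &
       forall t, ref_cell k t -> v (cell_map K t) = p t].

End geometry.

Section sobolev.
Variables (R : realType) (d : nat).
Local Notation V := 'rV[R]_d.
Implicit Types (D G : set V).

Definition partial (i : 'I_d) (f : V -> R) (x : V) : R :=
  'D_(delta_mx ord0 i) f x.

Definition gradient (f : V -> R) (x : V) : V := \row_i partial i f x.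

Definition C1_on D (f : V -> R) :=
  (forall x, D x -> differentiable f x) /\
  forall i, {within D, continuous (partial i f)}.

Fixpoint Cn (n : nat) (f : V -> R) : Prop :=
  continuous f /\
  (if n is n'.+1 then
     forall i, (forall x, derivable f x (delta_mx ord0 i)) /\ Cn n' (partial i f)
   else True).

Definition test_function D (phi : V -> R) :=
  (forall n, Cn n phi) /\
  exists K : set V, [/\ compact K, K `<=` D & forall x, ~ K x -> phi x = 0].

Definition L2 D (f : V -> R) :=
  measurable_fun D f /\
  (leb R d).-integrable D (fun x => (f x ^+ 2)%:E).

(* H^1(D) is realised as the graph of the weak gradient: its elements are the
   pairs (u, g) with u, g in L^2(D) and g the weak gradient of u, which
   determines g almost everywhere. *)
Definition sobolev_fun : lmodType R := ((V -> R) * (V -> V))%type.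

Definition fval (u : sobolev_fun) : V -> R := u.1.
Definition fgrad (u : sobolev_fun) : V -> V := u.2.

Definition H1 D : set sobolev_fun :=
  [set u | [/\ L2 D (fval u),
    forall i, L2 D (fun x => fgrad u x ord0 i) &
    forall phi, test_function D phi -> forall i,
      \int[leb R d]_(x in D) (fval u x * partial i phi x) =
      - \int[leb R d]_(x in D) (fgrad u x ord0 i * phi x)]].

Definition H1_normsq D (u : sobolev_fun) : R :=
  \int[leb R d]_(x in D) (fval u x ^+ 2 + dotp (fgrad u x) (fgrad u x)).

(* Zero trace on the boundary part G: H^1-limits of functions of H^1(D)
   vanishing near G.  For G empty this is H^1(D). *)
Definition H1_zero D G : set sobolev_fun :=
  [set u | H1 D u /\
    forall e : R, 0 < e -> exists2 phi, H1 D phi &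
      (exists U : set V, [/\ open U, G `<=` U &
         {ae leb R d, forall x, D x -> U x -> fval phi x = 0}]) /\
      H1_normsq D (u - phi) < e].

(* chi * u for a C^1 function chi, its gradient being given by the Leibniz
   rule *)
Definition cutoff (chi : V -> R) (u : sobolev_fun) : sobolev_fun :=
  (fun x => chi x * fval u x,
   fun x => fval u x *: gradient chi x + chi x *: fgrad u x).

Definition apply_coef (A : V -> 'M[R]_d) (g : V -> V) (x : V) : V :=
  (A x *m (g x)^T)^T.

Definition energy (A : V -> 'M[R]_d) D (u v : sobolev_fun) : R :=
  \int[leb R d]_(x in D) dotp (apply_coef A (fgrad u) x) (fgrad v x).

End sobolev.

Section operators.
Variables (R : realType) (E : lmodType R) (a : E -> E -> R).
Implicit Types (V W : set E) (S : E -> E) (u v : E).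

Definition anorm u : R := Num.sqrt (a u u).

(* Equality in the inner product space (V, a): functions are representatives,
   and two of them are the same element when their distance is zero.  Operators
   and linear independence below are understood modulo this equality. *)
Definition aeq u v := anorm (u - v) = 0.

Definition maps V W S := forall u, V u -> W (S u).

Definition linear_op V S := forall (c : R) u v, V u -> V v ->
  aeq (S (c *: u + v)) (c *: S u + S v).

Definition bounded_op V (C : R) S := forall u, V u -> anorm (S u) <= C * anorm u.

Definition positive_op V S := forall u, V u -> 0 <= a (S u) u.

Definition selfadjoint_op V S := forall u v, V u -> V v -> a (S u) v = a u (S v).

Definition increasing_index (s : nat -> nat) := forall n, (s n < s n.+1)%N.

Definition compact_op V S := forall u : nat -> E,
  (forall n, V (u n)) -> (exists C, forall n, anorm (u n) <= C) ->
  exists2 s, increasing_index s &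
  exists2 w, V w & anorm (S (u (s n)) - w) @[n --> \oo] --> (0 : R).

Definition eigen_space V S (lambda : R) : set E :=
  [set u | V u /\ aeq (S u) (lambda *: u)].

Definition lin_indep n (e : 'I_n -> E) := forall c : 'I_n -> R,
  aeq (\sum_i c i *: e i) 0 -> forall i, c i = 0.

Definition dim_ge V n := exists e : 'I_n -> E, (forall i, V (e i)) /\ lin_indep e.

(* Indices start at 0: mu 0 >= mu 1 >= ... lists the positive eigenvalues of S
   on V, each repeated according to its multiplicity (the dimension of its
   eigenspace); mu k = 0 when there are at most k of them. *)
Definition eigenvalue_sequence V S (mu : nat -> R) :=
  [/\ forall k, mu k.+1 <= mu k, forall k, 0 <= mu k &
      forall lambda, 0 < lambda -> forall n,
        dim_ge (eigen_space V S lambda) n <->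
        exists j : 'I_n -> nat, injective j /\ forall i, mu (j i) = lambda].

End operators.

Record local_problem (R : realType) (d : nat) := LocalProblem {
  Omega : set 'rV[R]_d;
  dOmegaD : set 'rV[R]_d;
  dOmegaN : set 'rV[R]_d;
  coefA : 'rV[R]_d -> 'M[R]_d;
  alpha : R;
  beta : R;
  omega : set 'rV[R]_d;
  omegas : set 'rV[R]_d;              (* omega^* *)
  chi : 'rV[R]_d -> R;
  C1 : R;
  kind : cell_kind;
  sigma : R;                          (* shape-regularity constant *)
  (* tau h, 0 < h <= 1, has mesh size h in the sense that no cell has a diameter
     larger than h *)
  tau : R -> seq (cell R d);

  Omega_domain : subdomain Omega;
  Omega_bounded : bounded_set Omega;
  Omega_polyhedral : polyhedral Omega;
  Omega_lipschitz : lipschitz_boundary Omega;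
  dOmega_disjoint : dOmegaD `&` dOmegaN = set0;
  dOmega_cover : closure dOmegaD `|` closure dOmegaN = bdry Omega;

  (* boundedness of the entries of A follows from symmetry and ellipticity *)
  coefA_measurable : forall i j, measurable_fun Omega (fun x => coefA x i j);
  alpha_beta : 0 < alpha < beta;
  coefA_elliptic : {ae leb R d, forall x, Omega x ->
    (coefA x)^T = coefA x /\
    forall xi, alpha * norm2 xi ^+ 2 <= dotp (coefA x *m xi^T)^T xi
                                     <= beta * norm2 xi ^+ 2};

  omega_domain : subdomain omega;
  omegas_domain : subdomain omegas;
  omega_sub : omega `<=` omegas;
  omegas_sub : omegas `<=` Omega;

  chi_range : forall x, 0 <= chi x <= 1;
  chi_support : forall x, Omega x -> ~ omega x -> chi x = 0;
  chi_C1 : C1_on omega chi;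
  chi_gradient : forall x, omega x -> norm2 (gradient chi x) <= C1 / diam omega;

  kind_rectangular : kind = Rectangular -> rectangular Omega;
  tau_triangulation : forall h, 0 < h <= 1 -> triangulation kind (tau h) Omega;
  tau_size : forall h, 0 < h <= 1 -> forall K, K \in tau h ->
    diam (cell_set kind K) <= h;
  tau_regular : forall h, 0 < h <= 1 -> shape_regular kind sigma (tau h);
  omegas_resolved : forall h, 0 < h <= 1 -> resolved_by kind (tau h) omegas
}.

Section local_spaces.
Variables (R : realType) (d : nat) (P : local_problem R d).
Local Notation E := (sobolev_fun R d).

Definition GammaD : set 'rV[R]_d := bdry (omegas P) `&` dOmegaD P.

Definition GammaDI : set 'rV[R]_d := GammaD `|` (bdry (omegas P) `&` Omega P).

Definition a_omegas : E -> E -> R := energy (coefA P) (omegas P).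

Definition H_AD : set E :=
  [set u | H1_zero (omegas P) GammaD u /\
     forall v, H1_zero (omegas P) GammaDI v -> a_omegas u v = 0].

(* restrictions to omega^* of the functions of V_h vanishing on G *)
Definition Vh_zero (h : R) (G : set 'rV[R]_d) : set E :=
  [set u | H1 (omegas P) u /\
     exists2 v, lagrange_space (kind P) (tau P h) (Omega P) v &
       {ae leb R d, forall x, omegas P x -> fval u x = v x} /\
       forall x, G x -> v x = 0].

Definition Wh_AD (h : R) : set E :=
  [set u | Vh_zero h GammaD u /\
     forall v, Vh_zero h GammaDI v -> a_omegas u v = 0].

Definition Momega (u : E) : R :=
  \int[leb R d]_(x in omega P)
    dotp (apply_coef (coefA P) (fgrad (cutoff (chi P) u)) x) (gradient (chi P) x).

Definition Hspace : set E :=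
  [set u | H_AD u /\ (GammaD = set0 -> Momega u = 0)].

Definition Whspace (h : R) : set E :=
  [set u | Wh_AD h u /\ (GammaD = set0 -> Momega u = 0)].

(* a_omega(chi u, chi v) *)
Definition b_chi (u v : E) : R :=
  energy (coefA P) (omega P) (cutoff (chi P) u) (cutoff (chi P) v).

(* S : V -> V is given by a_omegas(S u, v) = a_omega(chi u, chi v), v in V *)
Definition represents_b_chi (V : set E) (S : E -> E) :=
  maps V V S /\ forall u v, V u -> V v -> a_omegas (S u) v = b_chi u v.

End local_spaces.

(* Main.v *)
Require Import Defs.
From mathcomp Require Import ring lra.
From mathcomp Require Import measurable_realfun.

(** The theorem is a statement about compact positive self-adjoint operators
    between inner product spaces that vary with h, and it is proved as such: the
    finite element setting enters only through the fact that the energy form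
    a_omegas is symmetric, bilinear and nonnegative on Hspace and Whspace, and
    that these are linear spaces ([Hspace_semi_inner], [Whspace_semi_inner]).

    A positive compact self-adjoint operator S has its Rayleigh quotient
    maximised by an eigenvector ([top_eigenvector]); applied on orthogonal
    complements of eigenvectors this yields the max-min bound
    [courant_fischer]: if a(S v, v) >= lambda a(v, v) on a (k+1)-dimensional
    space, then the eigenvalue of index k is at least lambda.  The limits used in
    these arguments exist in the possibly incomplete space itself, by
    compactness of S.

    Lower semicontinuity of the eigenvalues ([muh_gt_near]): condition I and
    condition III make the Gram matrices of R_h u_0, ..., R_h u_k for a and for
    a(T_h ., .) converge to those of the eigenvectors u_i of T, so max-min for
    T_h applies to the span of the R_h u_i.

    Upper semicontinuity ([muh_lt_near]): if muh_k >= lambda > mu_k along some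
    h -> 0, take orthonormal eigenvectors x_0, ..., x_k of T_h.  Condition IV
    makes the T_h x_i converge, along a subsequence, to elements w_i of H in the
    sense of condition I; passing to the limit in the Gram matrices, the w_i are
    orthogonal and satisfy a(T v, v) >= lambda a(v, v) on their span, whence
    mu_k >= lambda by max-min for T.

    Error bound ([muh_error]): for unit vectors x and u with T_h x = muh_k x and
    T u = mu_k u, self-adjointness of T_h gives
      a(T_h R_h u - R_h T u, x) = (muh_k - mu_k) a(R_h u, x),
    so it is enough to have a(R_h u, x) >= 1/2.  If the bound failed along some
    h -> 0, then by condition IV the x would converge along a subsequence to
    some unit u in the eigenspace of mu_k, and a(R_h u, x) -> a(u, u) = 1. *)

Set Implicit Arguments.
Unset Strict Implicit.
Unset Printing Implicit Defensive.

Local Open Scope classical_set_scope.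
Local Open Scope ring_scope.

(** * Spaces with a semi-inner product *)

Section SemiInner.
Variables (R : realType) (E : lmodType R) (a : E -> E -> R).
Implicit Types (V : set E) (S : E -> E) (u v w : E).

(** The form is only required to behave on V: the energy of two arbitrary pairs
    of functions is an integral that need not converge. *)
Record semi_inner V : Prop := SemiInner {
  si_0 : V 0;
  si_closed : forall (c : R) u v, V u -> V v -> V (c *: u + v);
  si_sym : forall u v, V u -> V v -> a u v = a v u;
  si_linl : forall (c : R) u v w, V u -> V v -> V w ->
    a (c *: u + v) w = c * a u w + a v w;
  si_ge0 : forall u, V u -> 0 <= a u u }.

Variables (V : set E) (aV : semi_inner V).

Lemma si_D u v : V u -> V v -> V (u + v).
Proof. by move=> Vu Vv; rewrite -[u]scale1r; exact: (si_closed aV). Qed.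

Lemma si_Z c u : V u -> V (c *: u).
Proof. by move=> Vu; rewrite -[_ *: _]addr0; apply: (si_closed aV) => //; exact: (si_0 aV). Qed.

Lemma si_B u v : V u -> V v -> V (u - v).
Proof. by move=> Vu Vv; rewrite -scaleN1r; apply: si_D => //; exact: si_Z. Qed.

Lemma si_sum n (c : 'I_n -> R) (e : 'I_n -> E) :
  (forall i, V (e i)) -> V (\sum_i c i *: e i).
Proof.
move=> Ve; elim/big_ind : _ => //; first exact: (si_0 aV).
  exact: si_D.
by move=> i _; exact: si_Z.
Qed.

Lemma si_Dl u v w : V u -> V v -> V w -> a (u + v) w = a u w + a v w.
Proof. by move=> Vu Vv Vw; rewrite -[u in LHS]scale1r (si_linl aV)// mul1r. Qed.

Lemma si_0l w : V w -> a 0 w = 0.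
Proof.
move=> Vw; have V0 := si_0 aV.
by have := si_Dl V0 V0 Vw; rewrite addr0 => /eqP; rewrite addrC -subr_eq subrr => /eqP.
Qed.

Lemma si_Zl c u w : V u -> V w -> a (c *: u) w = c * a u w.
Proof.
by move=> Vu Vw; have := si_linl aV c Vu (si_0 aV) Vw; rewrite addr0 si_0l// addr0.
Qed.

Lemma si_Bl u v w : V u -> V v -> V w -> a (u - v) w = a u w - a v w.
Proof.
by move=> Vu Vv Vw; rewrite -scaleN1r si_Dl//; [rewrite si_Zl// mulN1r|exact: si_Z].
Qed.

Lemma si_suml n (c : 'I_n -> R) (e : 'I_n -> E) w : (forall i, V (e i)) -> V w ->
  a (\sum_i c i *: e i) w = \sum_i c i * a (e i) w.
Proof.
elim: n c e => [|n IH] c e Ve Vw; first by rewrite !big_ord0 si_0l.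
rewrite !big_ord_recl si_Dl ?IH ?si_Zl//; last by apply: si_sum.
exact: si_Z.
Qed.

Lemma si_Zr c u w : V u -> V w -> a w (c *: u) = c * a w u.
Proof. by move=> Vu Vw; rewrite (si_sym aV)//; [rewrite si_Zl// (si_sym aV)|exact: si_Z]. Qed.

Lemma si_Br u v w : V u -> V v -> V w -> a w (u - v) = a w u - a w v.
Proof.
move=> Vu Vv Vw; rewrite (si_sym aV) //; last exact: si_B.
by rewrite si_Bl// (si_sym aV Vw Vu) (si_sym aV Vw Vv).
Qed.

Lemma si_Dr u v w : V u -> V v -> V w -> a w (u + v) = a w u + a w v.
Proof.
move=> Vu Vv Vw; rewrite (si_sym aV) //; last exact: si_D.
by rewrite si_Dl// (si_sym aV Vw Vu) (si_sym aV Vw Vv).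
Qed.

Lemma si_sumr n (c : 'I_n -> R) (e : 'I_n -> E) w : (forall i, V (e i)) -> V w ->
  a w (\sum_i c i *: e i) = \sum_i c i * a w (e i).
Proof.
move=> Ve Vw; rewrite (si_sym aV)//; last exact: si_sum.
by rewrite si_suml//; apply: eq_bigr => i _; rewrite (si_sym aV).
Qed.

Lemma sqr_anorm u : V u -> anorm a u ^+ 2 = a u u.
Proof. by move=> Vu; rewrite sqr_sqrtr//; exact: (si_ge0 aV). Qed.

Lemma anorm_ge0 u : 0 <= anorm a u.
Proof. exact: sqrtr_ge0. Qed.

(** The discriminant argument, with the degenerate case a(u, u) = 0 treated
    apart because the form is only semidefinite. *)
Lemma cauchy_schwarz_sq u v : V u -> V v -> a u v ^+ 2 <= a u u * a v v.
Proof.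
move=> Vu Vv.
have q t : 0 <= a u u * t ^+ 2 + 2 * t * a u v + a v v.
  have Vt : V (t *: u + v) by exact: (si_closed aV).
  have := si_ge0 aV Vt; rewrite (si_linl aV)// si_Dr ?si_Zr//; last exact: si_Z.
  rewrite si_Dr ?si_Zr//; last exact: si_Z.
  by rewrite (si_sym aV Vv Vu); lra.
have [u0|u0] := eqVneq (a u u) 0.
  rewrite u0 mul0r; have [->|uv0] := eqVneq (a u v) 0; first by rewrite expr0n.
  have := q (- (a v v + 1) / (2 * a u v)); rewrite u0 mul0r add0r.
  have -> : 2 * (- (a v v + 1) / (2 * a u v)) * a u v = - (a v v + 1) by field.
  by rewrite leNgt => /negP; case; lra.
have u_gt0 : 0 < a u u by rewrite lt_neqAle eq_sym u0 (si_ge0 aV).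
have := q (- a u v / a u u).
have -> : a u u * (- a u v / a u u) ^+ 2 + 2 * (- a u v / a u u) * a u v + a v v
  = (a u u * a v v - a u v ^+ 2) / a u u by field.
by rewrite pmulr_lge0 ?invr_gt0// subr_ge0.
Qed.

Lemma cauchy_schwarz u v : V u -> V v -> `|a u v| <= anorm a u * anorm a v.
Proof.
move=> Vu Vv; rewrite -ler_sqr ?nnegrE ?mulr_ge0 ?anorm_ge0// real_normK ?num_real//.
by rewrite exprMn !sqr_anorm// cauchy_schwarz_sq.
Qed.

Lemma anormZ c u : V u -> anorm a (c *: u) = `|c| * anorm a u.
Proof.
move=> Vu; rewrite /anorm si_Zl ?si_Zr//; last exact: si_Z.
by rewrite mulrA -expr2 sqrtrM ?sqr_ge0// sqrtr_sqr.
Qed.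

Lemma anormD u v : V u -> V v -> anorm a (u + v) <= anorm a u + anorm a v.
Proof.
move=> Vu Vv; rewrite -ler_sqr ?nnegrE ?addr_ge0 ?anorm_ge0// sqr_anorm; last exact: si_D.
rewrite si_Dl ?si_Dr//; last exact: si_D.
rewrite sqrrD !sqr_anorm// (si_sym aV Vv Vu).
have := cauchy_schwarz Vu Vv; have := ler_norm (a u v).
by rewrite -mulr_natr; lra.
Qed.

Lemma anormN u : V u -> anorm a (- u) = anorm a u.
Proof. by move=> Vu; rewrite -scaleN1r anormZ// normrN1 mul1r. Qed.

Lemma anormC u v : V u -> V v -> anorm a (u - v) = anorm a (v - u).
Proof. by move=> Vu Vv; rewrite -(opprB u v) anormN//; exact: si_B. Qed.

Lemma anorm_tri u v w : V u -> V v -> V w ->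
  anorm a (u - w) <= anorm a (u - v) + anorm a (v - w).
Proof.
move=> Vu Vv Vw; have -> : u - w = (u - v) + (v - w) by rewrite addrA subrK.
by apply: anormD; exact: si_B.
Qed.

Lemma anorm_dist u v : V u -> V v -> `|anorm a u - anorm a v| <= anorm a (u - v).
Proof.
move=> Vu Vv; have V0 := si_0 aV.
have := anorm_tri Vu Vv V0; have := anorm_tri Vv Vu V0.
by rewrite !subr0 (anormC Vv Vu) ler_norml => *; apply/andP; split; lra.
Qed.

(** By the Cauchy-Schwarz inequality, vectors at distance zero cannot be told
    apart by the form; equations between operators are therefore handled by
    testing against all of V. *)
Lemma aeqP u v : V u -> V v -> aeq a u v <-> (forall w, V w -> a u w = a v w).
Proof.
move=> Vu Vv; have Vuv := si_B Vu Vv; split=> [uv w Vw|uv].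
  apply/eqP; rewrite -subr_eq0 -si_Bl// -normr_eq0 eq_le normr_ge0 andbT.
  by have := cauchy_schwarz Vuv Vw; rewrite uv mul0r.
by rewrite /aeq /anorm si_Bl// (uv _ Vuv) subrr sqrtr0.
Qed.

Lemma aeq_anorm u v : V u -> V v -> aeq a u v -> anorm a u = anorm a v.
Proof.
move=> Vu Vv uv; apply/eqP; rewrite -subr_eq0 -normr_eq0 eq_le normr_ge0 andbT.
by have := anorm_dist Vu Vv; rewrite uv.
Qed.

End SemiInner.

(** * Limits along subsequences *)

Section Limits.
Variables (R : realType).

Lemma cvg0_squeeze (T : Type) (F : set_system T) (FF : Filter F) (f g : T -> R) :
  (forall x, 0 <= f x <= g x) -> g @ F --> (0 : R) -> f @ F --> (0 : R).
Proof.
move=> fg g0; apply: (squeeze_cvgr _ (cvg_cst 0) g0).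
by near=> x; exact: fg.
Unshelve. all: by end_near. Qed.

Lemma increasing_index_ge s : increasing_index s -> forall n, (n <= s n)%N.
Proof. by move=> si; elim=> // n /leq_ltn_trans; apply. Qed.

Lemma increasing_index_lt s i j : increasing_index s -> (i < j)%N -> (s i < s j)%N.
Proof.
move=> si; elim: j => // j IH; rewrite ltnS leq_eqVlt => /predU1P[->//|/IH ij].
exact: ltn_trans ij (si j).
Qed.

Lemma increasing_index_comp s t : increasing_index s -> increasing_index t ->
  increasing_index (s \o t).
Proof. by move=> si ti n; exact: (increasing_index_lt si). Qed.

Lemma increasing_index_cvg s : increasing_index s -> s @ \oo --> \oo.
Proof.
move=> si A [N _ NA]; exists N => // n /= Nn; apply: NA => /=.
exact: leq_trans Nn (increasing_index_ge si n).
Qed.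

Lemma cvg_subseq_index (u : nat -> R) (l : R) s : increasing_index s ->
  u @ \oo --> l -> u (s n) @[n --> \oo] --> l.
Proof. by move=> /increasing_index_cvg si ul; exact: (cvg_comp _ _ si ul). Qed.

End Limits.

(** * Compact positive self-adjoint operators *)

Section CompactOperator.
Variables (R : realType) (E : lmodType R) (a : E -> E -> R).
Implicit Types (V : set E) (S : E -> E) (u v w : E).

Record compact_positive_op V S : Prop := CompactPositiveOp {
  cpop_maps : maps V V S;
  cpop_pos : positive_op a V S;
  cpop_compact : compact_op a V S;
  cpop_sa : selfadjoint_op a V S }.

Section Basics.
Variables (V : set E) (S : E -> E).
Hypotheses (aV : semi_inner a V) (SV : compact_positive_op V S).

Let VS := cpop_maps SV.

(** Self-adjointness moves the operator to the other argument, where the form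
    is linear. *)
Lemma cpop_lin c u v w : V u -> V v -> V w ->
  a (S (c *: u + v)) w = c * a (S u) w + a (S v) w.
Proof.
move=> Vu Vv Vw; have Vw' := VS Vw.
by rewrite !(cpop_sa SV)// ?(si_linl aV)//; exact: (si_closed aV).
Qed.

Lemma cpop_semi_inner : semi_inner (fun u v => a (S u) v) V.
Proof.
split; [exact: (si_0 aV)|exact: (si_closed aV)|..].
- by move=> u v Vu Vv; rewrite (cpop_sa SV)// (si_sym aV)//; exact: VS.
- by move=> *; exact: cpop_lin.
- by move=> u Vu; exact: (cpop_pos SV).
Qed.

Lemma cpop_anormZ c u : V u -> anorm a (S (c *: u)) = `|c| * anorm a (S u).
Proof.
move=> Vu; rewrite -(anormZ aV)//; last exact: VS.
apply: (aeq_anorm aV); [by apply: VS; exact: (si_Z aV)|by apply: (si_Z aV); exact: VS|].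
apply/(aeqP aV); [by apply: VS; exact: (si_Z aV)|by apply: (si_Z aV); exact: VS|].
move=> w Vw; have SVw := VS Vw; have SVu := VS Vu.
by rewrite (cpop_sa SV)// ?(si_Zl aV)// ?(cpop_sa SV)//; exact: (si_Z aV).
Qed.

Lemma unit_scale u : V u -> anorm a u != 0 -> anorm a ((anorm a u)^-1 *: u) = 1.
Proof.
move=> Vu u0; rewrite (anormZ aV)// ger0_norm ?mulVf// invr_ge0.
exact: anorm_ge0.
Qed.

Lemma rayleigh_unit u : V u -> anorm a u != 0 ->
  a (S u) u / a u u =
  a (S ((anorm a u)^-1 *: u)) ((anorm a u)^-1 *: u).
Proof.
move=> Vu u0; have Vu' := si_Z aV (anorm a u)^-1 Vu.
have VSu := VS Vu; have VSu' := VS Vu'.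
rewrite (si_Zr aV)// (cpop_sa SV Vu' Vu) (si_Zl aV)// -(cpop_sa SV Vu Vu).
by rewrite -(sqr_anorm aV)//; field.
Qed.

(** The operator respects the equality [aeq], again through self-adjointness. *)
Lemma cpop_kernel u : V u -> anorm a u = 0 -> anorm a (S u) = 0.
Proof.
move=> Vu u0; rewrite /anorm (cpop_sa SV)//; last exact: VS.
have := cauchy_schwarz aV Vu (VS (VS Vu)).
by rewrite u0 mul0r normr_le0 => /eqP ->; rewrite sqrtr0.
Qed.

(** Unit vectors u_n with |S u_n| > n would have no subsequence along which
    S u_n converges. *)
Lemma cpop_bounded : exists2 C, 0 <= C & bounded_op a V C S.
Proof.
apply: contrapT => nb.
have unb n : exists u, [/\ V u, anorm a u = 1 & n%:R < anorm a (S u)].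
  apply: contrapT => nu; apply: nb; exists n%:R => // u Vu.
  have [u0|u0] := eqVneq (anorm a u) 0; first by rewrite u0 mulr0 cpop_kernel.
  rewrite leNgt; apply/negP => lt; apply: nu; exists ((anorm a u)^-1 *: u); split.
  - exact: (si_Z aV).
  - exact: unit_scale.
  - rewrite cpop_anormZ// ger0_norm ?invr_ge0 ?anorm_ge0//.
    by rewrite mulrC ltr_pdivlMr// lt_neqAle eq_sym u0 anorm_ge0.
have [u uP] := choice unb.
have Vu n : V (u n) by case: (uP n).
have [|s si [w Vw Sw]] := cpop_compact SV Vu.
  by exists 1 => n; case: (uP n) => _ ->.
have [n sn] : exists n, anorm a (S (u (s n)) - w) < 1 /\ anorm a w + 1 < n%:R.
  near \oo => n; exists n; split; near: n.
    by apply: (cvgr_lt (0 : R)) => //; exact: ltr01.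
  exact: nbhs_infty_gtr.
have [_ _ nS] := uP (s n); have VSu := VS (Vu (s n)).
have := anormD aV (si_B aV VSu Vw) Vw; rewrite subrK.
have : n%:R <= (s n)%:R :> R by rewrite ler_nat; exact: increasing_index_ge.
by case: sn => *; lra.
Unshelve. all: by end_near. Qed.

(** Let L be the supremum of the Rayleigh quotient, and u_n unit vectors with
    a(S u_n, u_n) -> L.  The Cauchy-Schwarz inequality for the form a(S ., .)
    gives |S u|^2 <= L a(S u, u), so |S u_n - L u_n|^2 <= L (L - a(S u_n, u_n))
    tends to 0; a limit point of S u_n, which exists by compactness, is then an
    eigenvector for L. *)
Lemma top_eigenvector lambda v : 0 <= lambda -> V v ->
  lambda * a v v < a (S v) v ->
  exists2 Lambda, lambda < Lambda &
  exists u, eigen_space a V S Lambda u /\ anorm a u = 1.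
Proof.
move=> lambda_ge0 Vv vlt.
have [C C_ge0 SC] := cpop_bounded.
pose Q := [set r | exists u, [/\ V u, anorm a u = 1 & r = a (S u) u]].
pose L := sup Q.
have v0 : anorm a v != 0.
  apply/eqP => v0; move: vlt; have := cauchy_schwarz aV (VS Vv) Vv.
  by rewrite -(sqr_anorm aV)// v0 !mulr0 normr_le0 => /eqP ->; rewrite expr0n/= mulr0 ltxx.
have Qub : ubound Q C.
  move=> _ [u [Vu u1 ->]]; apply: le_trans (ler_norm _) _.
  apply: le_trans (cauchy_schwarz aV (VS Vu) Vu) _.
  by have := SC _ Vu; rewrite u1 !mulr1.
have Qv : Q (a (S v) v / a v v).
  exists ((anorm a v)^-1 *: v); split; [exact: (si_Z aV)|exact: unit_scale|].
  exact: rayleigh_unit.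
have hsQ : has_sup Q by split; [eexists; exact: Qv|exists C].
have vv_gt0 : 0 < a v v.
  by rewrite -(sqr_anorm aV)// exprn_gt0// lt_neqAle eq_sym v0 anorm_ge0.
have lL : lambda < L.
  apply: (@lt_le_trans _ _ (a (S v) v / a v v)); first by rewrite ltr_pdivlMr.
  exact: sup_upper_bound.
have L_gt0 : 0 < L by exact: le_lt_trans lL.
have QL u : V u -> a (S u) u <= L * a u u.
  move=> Vu; have [u0|u0] := eqVneq (anorm a u) 0.
    have := cauchy_schwarz aV (VS Vu) Vu.
    by rewrite -(sqr_anorm aV)// u0 !mulr0 expr0n/= mulr0 normr_le0 => /eqP ->.
  have uu : 0 < a u u.
    by rewrite -(sqr_anorm aV)// exprn_gt0// lt_neqAle eq_sym u0 anorm_ge0.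
  rewrite -ler_pdivrMr//; apply: sup_upper_bound => //.
  exists ((anorm a u)^-1 *: u); split; [exact: (si_Z aV)|exact: unit_scale|].
  exact: rayleigh_unit.
have exu n : exists u, [/\ V u, anorm a u = 1 & L - n.+1%:R^-1 < a (S u) u].
  have n_gt0 : 0 < n.+1%:R^-1 :> R by rewrite invr_gt0.
  by have [_ [u [Vu u1 ->]] Lu] := sup_adherent n_gt0 hsQ; exists u.
have [u uP] := choice exu.
have Vu n : V (u n) by case: (uP n).
have VSu n : V (S (u n)) by exact: VS.
have VLu n : V (L *: u n) by exact: (si_Z aV).
have u1 n : anorm a (u n) = 1 by case: (uP n).
have [|s si [w Vw Sw]] := cpop_compact SV Vu; first by exists 1 => n; rewrite u1.
have approx n : anorm a (S (u n) - L *: u n) ^+ 2 <= L * harmonic n.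
  rewrite (sqr_anorm aV); last exact: (si_B aV).
  rewrite (si_Bl aV) ?(si_Br aV) ?(si_Zl aV) ?(si_Zr aV)//; last exact: (si_B aV).
  rewrite -(cpop_sa SV (Vu n) (Vu n)) -(sqr_anorm aV (Vu n)) u1 expr1n mulr1.
  have : a (S (u n)) (S (u n)) <= L * a (S (u n)) (u n).
    have X_ge0 := si_ge0 aV (VSu n); have := QL _ (VSu n).
    have := cauchy_schwarz_sq cpop_semi_inner (Vu n) (VSu n).
    have := cpop_pos SV (Vu n).
    set X := a (S (u n)) (S (u n)) in X_ge0 *; set p := a (S (u n)) (u n).
    move=> p0 Xp SX; have [->|X0] := eqVneq X 0; first by rewrite mulr_ge0// ltW.
    have {X0}X_gt0 : 0 < X by rewrite lt_neqAle eq_sym X0.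
    rewrite -(ler_pM2r X_gt0) -expr2 (le_trans Xp)//.
    by rewrite [L * p]mulrC -mulrA ler_wpM2l.
  have [_ _] := uP n; rewrite /harmonic /=.
  set p := a (S (u n)) (u n); set h := (_^-1) => Lp Xp.
  have : L * (L - h) <= L * p by rewrite ler_pM2l// ltW.
  lra.
have approx0 : anorm a (S (u n) - L *: u n) @[n --> \oo] --> (0 : R).
  apply: (@cvg0_squeeze _ _ _ _ _ (fun n => Num.sqrt (L * harmonic n))).
    move=> n; rewrite anorm_ge0/= -[leLHS]ger0_norm ?anorm_ge0// -sqrtr_sqr.
    by rewrite ler_sqrt// mulr_ge0 ?(ltW L_gt0)// /harmonic/= invr_ge0.
  rewrite -[X in _ --> X]sqrtr0; apply: continuous_cvg; first exact: sqrt_continuous.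
  by rewrite -[X in _ --> X](mulr0 L); apply: cvgMl_tmp; exact: cvg_harmonic.
have Lw : anorm a (L *: u (s n) - w) @[n --> \oo] --> (0 : R).
  apply: (@cvg0_squeeze _ _ _ _ _ (fun n => anorm a (S (u (s n)) - L *: u (s n)) +
     anorm a (S (u (s n)) - w))) => [n|].
    by rewrite anorm_ge0/= (anormC aV (VSu _) (VLu _)) (anorm_tri aV).
  rewrite -[X in _ --> X](addr0 0); apply: cvgD => //.
  exact: (cvg_subseq_index si approx0).
have wL : anorm a w = L.
  apply/eqP; rewrite -subr_eq0 -normr_le0.
  apply: (cvgr_to_ge Lw); near=> n; rewrite distrC.
  have := anorm_dist aV (VLu (s n)) Vw.
  by rewrite (anormZ aV)// u1 mulr1 (ger0_norm (ltW L_gt0)).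
have Sw_eq : aeq a (S w) (L *: w).
  apply/(aeqP aV); [exact: VS|exact: (si_Z aV)|move=> x Vx].
  have VSx := VS Vx.
  apply/eqP; rewrite -subr_eq0 -normr_le0.
  have lim0 : anorm a (L *: u (s n) - w) * anorm a (S x) +
      L * (anorm a (S (u (s n)) - w) * anorm a x) @[n --> \oo] --> (0 : R).
    rewrite -[X in _ --> X](addr0 0); apply: cvgD.
      by rewrite -[X in _ --> X](mul0r (anorm a (S x))); apply: cvgMr_tmp.
    by rewrite -[X in _ --> X](mulr0 L); apply: cvgMl_tmp;
       rewrite -[X in _ --> X](mul0r (anorm a x)); apply: cvgMr_tmp.
  apply: (cvgr_to_ge lim0); near=> n.
  have := cauchy_schwarz aV (si_B aV (VLu (s n)) Vw) VSx.
  have := cauchy_schwarz aV (si_B aV (VSu (s n)) Vw) Vx.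
  rewrite !(si_Bl aV)// !(si_Zl aV)// -!(cpop_sa SV)//.
  set p := _ * anorm a x; set q := _ * anorm a (S x) => hp.
  have : `|L * (a (S (u (s n))) x - a w x)| <= L * p.
    by rewrite normrM gtr0_norm// ler_pM2l.
  by rewrite !ler_norml => /andP[? ?] /andP[? ?]; apply/andP; split; lra.
exists L => //; exists (L^-1 *: w); split; last first.
  by rewrite -wL unit_scale// wL gt_eqF.
split; first exact: (si_Z aV).
have VLw := si_Z aV L^-1 Vw.
apply/(aeqP aV); [exact: VS|exact: (si_Z aV)|move=> x Vx].
rewrite (cpop_sa SV)// !(si_Zl aV)//; last exact: VS.
rewrite -(cpop_sa SV)// (proj1 (aeqP aV (VS Vw) (si_Z aV L Vw)) Sw_eq)//.
by rewrite (si_Zl aV)//; ring.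
Unshelve. all: by end_near. Qed.

End Basics.
End CompactOperator.

(** * Eigenbases and the max-min principle *)

Lemma underdetermined_system (F : fieldType) m n (M : 'M[F]_(n, m)) : (m < n)%N ->
  exists c : 'I_n -> F, (exists i, c i != 0) /\
    forall q, \sum_p c p * M p q = 0.
Proof.
move=> mn; have : kermx M != 0.
  rewrite kermx_eq0 -row_leq_rank -ltnNge; apply: leq_ltn_trans mn.
  exact: rank_leq_col.
case/matrix0Pn => p0 [p1 p01]; exists (fun p => kermx M p0 p); split; first by exists p1.
by move=> q; have /matrixP/(_ p0 q) := mulmx_ker M; rewrite !mxE.
Qed.

Section Spectrum.
Variables (R : realType) (E : lmodType R) (a : E -> E -> R).
Variables (V : set E) (S : E -> E) (mu : nat -> R).
Hypotheses (aV : semi_inner a V) (SV : compact_positive_op a V S).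
Hypothesis mu_eig : eigenvalue_sequence a V S mu.
Implicit Types (u v w : E).

Let VS := cpop_maps SV.

Lemma orthonormal_lin_indep n (e : 'I_n -> E) : (forall i, V (e i)) ->
  (forall i j, a (e i) (e j) = (i == j)%:R) -> lin_indep a e.
Proof.
move=> Ve ee c /(aeqP aV (si_sum aV c Ve) (si_0 aV)) ce i.
have := ce _ (Ve i); rewrite (si_suml aV)// (si_0l aV)// (bigD1 i)//= ee eqxx mulr1.
rewrite big1 ?addr0// => j ji; rewrite ee.
by rewrite (negbTE ji) mulr0.
Qed.

Lemma eigen_space_sum lambda n (c : 'I_n -> R) (e : 'I_n -> E) :
  (forall i, eigen_space a V S lambda (e i)) ->
  eigen_space a V S lambda (\sum_i c i *: e i).
Proof.
move=> Ee; have Ve i : V (e i) by case: (Ee i).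
have Vs := si_sum aV c Ve; split => //.
apply/(aeqP aV); [exact: VS|exact: (si_Z aV)|move=> x Vx].
rewrite (cpop_sa SV)// (si_Zl aV)// !(si_suml aV)//; last exact: VS.
rewrite mulr_sumr; apply: eq_bigr => i _; rewrite -(cpop_sa SV)//.
have [_ Si] := Ee i.
rewrite (proj1 (aeqP aV (VS (Ve i)) (si_Z aV _ (Ve i))) Si)// (si_Zl aV)//.
by rewrite mulrCA.
Qed.

Lemma eigen_inner lambda u w : eigen_space a V S lambda u -> V w ->
  a (S u) w = lambda * a u w.
Proof.
move=> [Vu Su] Vw.
by rewrite (proj1 (aeqP aV (VS Vu) (si_Z aV _ Vu)) Su)// (si_Zl aV).
Qed.

Lemma eigen_orth lambda nu u v : lambda != nu ->
  eigen_space a V S lambda u -> eigen_space a V S nu v -> a u v = 0.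
Proof.
move=> ln Eu Ev; have [Vu _] := Eu; have [Vv _] := Ev.
have : (lambda - nu) * a u v = 0.
  rewrite mulrBl -(eigen_inner Eu Vv) (cpop_sa SV)// (si_sym aV Vu (VS Vv)).
  by rewrite (eigen_inner Ev Vu) (si_sym aV Vv Vu) subrr.
by move/eqP; rewrite mulf_eq0 subr_eq0 (negbTE ln) => /eqP.
Qed.

Lemma mu_nonincr i j : (i <= j)%N -> mu j <= mu i.
Proof.
case: mu_eig => mun _ _; elim: j => [|j IH]; first by rewrite leqn0 => /eqP ->.
by rewrite leq_eqVlt => /predU1P[->//|/IH]; exact: le_trans.
Qed.

(** Orthonormal eigenvectors for the first k entries of mu, in this order. *)
Definition eigenbasis k (u : nat -> E) :=
  (forall i, (i < k)%N -> eigen_space a V S (mu i) (u i)) /\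
  (forall i j, (i < k)%N -> (j < k)%N -> a (u i) (u j) = (i == j)%:R).

(** Induction on k.  If m of the earlier entries equal mu k, the eigenspace of
    mu k has dimension at least m + 1, hence contains a nonzero combination
    orthogonal to the m vectors already chosen in it; it is orthogonal to the
    other ones because their eigenvalues differ. *)
Lemma eigenbasis_exists k : (forall i, (i < k)%N -> 0 < mu i) ->
  exists u : nat -> E, eigenbasis k u.
Proof.
elim: k => [|k IH] mu_gt0.
  by exists (fun=> 0); split.
have [|u [Eu uu]] := IH; first by move=> i ik; apply: mu_gt0; exact: ltnW.
have Vu i : (i < k)%N -> V (u i) by move=> /Eu[].
pose s := [seq i <- iota 0 k | mu i == mu k].
have sP i : i \in s = (i < k)%N && (mu i == mu k).
  by rewrite mem_filter mem_iota/= add0n andbC.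
have su : uniq (rcons s k).
  by rewrite rcons_uniq sP ltnn/= filter_uniq// iota_uniq.
(* Multiplicity of mu k: the indices in s, and k itself. *)
have [e [Ee ei]] : dim_ge a (eigen_space a V S (mu k)) (size s).+1.
  case: mu_eig => _ _ /(_ _ (mu_gt0 _ (ltnSn k)) (size s).+1)[_]; apply.
  exists (fun p : 'I_(size s).+1 => nth k (rcons s k) p); split.
    move=> p q /eqP; rewrite nth_uniq ?size_rcons//.
    by move=> /eqP/val_inj.
  move=> p; have : nth k (rcons s k) p \in rcons s k.
    by rewrite mem_nth// size_rcons.
  by rewrite mem_rcons inE => /predU1P[->//|]; rewrite sP => /andP[_ /eqP].
have Ve p : V (e p) by case: (Ee p).
have [c [[p0 cp0] cM]] := underdetermined_system
  (\matrix_(p < (size s).+1, q < size s) a (e p) (u (nth k s q))) (ltnSn _).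
pose w := \sum_p c p *: e p.
have Ew : eigen_space a V S (mu k) w by exact: eigen_space_sum.
have [Vw _] := Ew.
have w0 : anorm a w != 0.
  apply: contra cp0 => /eqP w0; apply/eqP; apply: ei.
  by rewrite /aeq subr0.
have wu i : (i < k)%N -> a w (u i) = 0.
  move=> ik; have [mik|mik] := eqVneq (mu i) (mu k).
    have si : i \in s by rewrite sP ik mik eqxx.
    have iM : (index i s < size s)%N by rewrite index_mem.
    have := cM (Ordinal iM); rewrite /w (si_suml aV)//; last exact: Vu.
    by under eq_bigr do rewrite mxE/= nth_index//.
  by apply: (eigen_orth _ Ew (Eu _ ik)); rewrite eq_sym.
pose w1 := (anorm a w)^-1 *: w.
have Vw1 : V w1 by exact: (si_Z aV).
have w1u i : (i < k)%N -> a w1 (u i) = 0.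
  by move=> ik; rewrite (si_Zl aV)//; [rewrite wu// mulr0|exact: Vu].
exists (fun i => if (i < k)%N then u i else w1); split.
  move=> i; rewrite ltnS leq_eqVlt => /predU1P[->|ik]; last by rewrite ik; exact: Eu.
  rewrite ltnn; have := @eigen_space_sum (mu k) 1 (fun=> (anorm a w)^-1) (fun=> w) (fun=> Ew).
  by rewrite big_ord1.
have w11 : a w1 w1 = 1 by rewrite -(sqr_anorm aV)// (unit_scale aV)// expr1n.
move=> i j; rewrite !ltnS [(i <= k)%N]leq_eqVlt [(j <= k)%N]leq_eqVlt.
move=> /predU1P[->|ik] /predU1P[->|jk]; rewrite ?ltnn ?ik ?jk ?eqxx.
- by [].
- by rewrite w1u// gtn_eqF.
- by rewrite (si_sym aV)//; [rewrite w1u// ltn_eqF|exact: Vu].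
- exact: uu.
Qed.

(** Otherwise [top_eigenvector] on the orthogonal complement of the u_i, i < k,
    produces a new eigenvector with an eigenvalue L > mu k.  Together with the
    u_i for L it makes the multiplicity of L exceed the number of entries of mu
    equal to L, all of which have an index below k. *)
Lemma eigenbasis_max k (u : nat -> E) v : eigenbasis k u -> V v ->
  (forall i, (i < k)%N -> a v (u i) = 0) -> a (S v) v <= mu k * a v v.
Proof.
move=> [Eu uu] Vv vu; rewrite leNgt; apply/negP => lt.
have Vu i : (i < k)%N -> V (u i) by move=> /Eu[].
pose V' := [set v | V v /\ forall i, (i < k)%N -> a v (u i) = 0].
have V'V x : V' x -> V x by case.
have aV' : semi_inner a V'.
  split.
  - by split=> [|i /Vu]; [exact: (si_0 aV)|exact: (si_0l aV)].
  - move=> c x y [Vx xu] [Vy yu]; split; first exact: (si_closed aV).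
    by move=> i ik; rewrite (si_linl aV) ?xu ?yu ?mulr0 ?addr0//; exact: Vu.
  - by move=> x y /V'V Vx /V'V Vy; exact: (si_sym aV).
  - by move=> c x y z /V'V Vx /V'V Vy /V'V Vz; exact: (si_linl aV).
  - by move=> x /V'V; exact: (si_ge0 aV).
have V'S : maps V' V' S.
  move=> x [Vx xu]; split; first exact: VS.
  move=> i ik; rewrite (cpop_sa SV)//; last exact: Vu.
  have [Vui _] := Eu _ ik.
  by rewrite (si_sym aV Vx (VS Vui)) (eigen_inner (Eu _ ik))// (si_sym aV)// xu// mulr0.
have SV' : compact_positive_op a V' S.
  split => //.
  - by move=> x /V'V; exact: (cpop_pos SV).
  - move=> x V'x xb.
    have Vx n : V (x n) by exact: V'V.
    have [s si [w Vw xw]] := cpop_compact SV Vx xb.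
    exists s => //; exists w => //; split => // i ik.
    have Vui := Vu _ ik.
    apply/eqP; rewrite -normr_le0.
    have lim0 : anorm a (S (x (s n)) - w) * anorm a (u i) @[n --> \oo] --> (0 : R).
      by rewrite -[X in _ --> X](mul0r (anorm a (u i))); exact: cvgMr_tmp.
    apply: (cvgr_to_ge lim0); near=> n.
    have VSx := VS (Vx (s n)).
    apply: le_trans (cauchy_schwarz aV (si_B aV VSx Vw) Vui).
    have [_ Sxu] := V'S _ (V'x (s n)).
    by rewrite (si_Bl aV)// Sxu// sub0r normrN.
  - by move=> x y /V'V Vx /V'V Vy; exact: (cpop_sa SV).
have muk_ge0 : 0 <= mu k by case: mu_eig.
have [L muL [x [[V'x Lx] x1]]] := top_eigenvector aV' SV' muk_ge0 (conj Vv vu : V' v) lt.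
have [Vx xu] := V'x.
have L_gt0 : 0 < L by exact: le_lt_trans muL.
pose s := [seq i <- iota 0 k | mu i == L].
have sP i : i \in s = (i < k)%N && (mu i == L).
  by rewrite mem_filter mem_iota/= add0n andbC.
have su : uniq s by rewrite filter_uniq// iota_uniq.
have snP p : (p < size s)%N -> (nth 0%N s p < k)%N /\ mu (nth 0%N s p) = L.
  by move=> ps; have := mem_nth 0%N ps; rewrite sP => /andP[? /eqP].
(* The chosen eigenvectors for L, followed by the new one. *)
pose e (p : 'I_(size s).+1) := if (p < size s)%N then u (nth 0%N s p) else x.
have Ee p : eigen_space a V S L (e p).
  rewrite /e; case: ifPn => // ps; have [pk <-] := snP _ ps; exact: Eu.
have [_ _ /(_ _ L_gt0 (size s).+1)[muP _]] := mu_eig.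
have [|j [jinj jL]] := muP.
  exists e; split => //; apply: orthonormal_lin_indep => [p|p q]; first by case: (Ee p).
  have szE (r : 'I_(size s).+1) : (r < size s)%N = false -> r = size s :> nat.
    by move=> /negbT; rewrite -leqNgt => sr; apply/eqP; rewrite eqn_leq -ltnS ltn_ord.
  rewrite /e; case: ifPn => [ps|/negbTE/szE ps]; case: ifPn => [qs|/negbTE/szE qs].
  - by rewrite uu ?nth_uniq//; [case: (snP _ ps)|case: (snP _ qs)].
  - have [pk _] := snP _ ps.
    rewrite (si_sym aV)//; last exact: Vu.
    by rewrite xu// -val_eqE/= qs ltn_eqF.
  - by have [qk _] := snP _ qs; rewrite xu// -val_eqE/= ps gtn_eqF.
  - by rewrite -val_eqE/= ps qs eqxx -(sqr_anorm aV)// x1 expr1n.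
have : (size (map j (enum 'I_(size s).+1)) <= size s)%N.
  apply: uniq_leq_size; first by rewrite map_inj_uniq// enum_uniq.
  move=> _ /mapP[p _ ->]; rewrite sP jL eqxx andbT ltnNge; apply/negP => kj.
  by have := mu_nonincr kj; rewrite jL leNgt muL.
by rewrite size_map size_enum_ord ltnn.
Unshelve. all: by end_near. Qed.

(** Entries of mu that vanish carry no eigenvectors; cutting the list at its
    first zero changes neither the value mu k nor the validity of the max-min
    argument. *)
Lemma positive_part k : exists k', [/\ (k' <= k)%N, mu k' = mu k &
  forall i, (i < k')%N -> 0 < mu i].
Proof.
have mu_ge0 i : 0 <= mu i by case: mu_eig.
elim: k => [|k [k' [k'k kk' pos]]]; first by exists 0%N.
have [k0|k0] := eqVneq (mu k) 0.
  exists k'; split => //; first exact: leqW.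
  apply/eqP; rewrite eq_le; apply/andP; split; first by rewrite kk' k0.
  by apply: mu_nonincr; exact: leqW.
exists k.+1; split => // i ik; apply: (@lt_le_trans _ _ (mu k)).
  by rewrite lt_neqAle eq_sym k0 mu_ge0.
by apply: mu_nonincr; rewrite -ltnS.
Qed.

(** The span of the k + 1 vectors w_i contains a nonzero vector orthogonal to
    the first k eigenvectors, where the Rayleigh quotient is at most mu k. *)
Lemma courant_fischer k lambda (w : 'I_k.+1 -> E) : (forall i, V (w i)) ->
  (forall c : 'I_k.+1 -> R, (exists i, c i != 0) ->
    let v := \sum_i c i *: w i in 0 < a v v /\ lambda * a v v <= a (S v) v) ->
  lambda <= mu k.
Proof.
move=> Vw wP; have [k' [k'k <- pos]] := positive_part k.
have [u ub] := eigenbasis_exists pos; have [Eu _] := ub.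
have Vu i : (i < k')%N -> V (u i) by move=> /Eu[].
have [c [c0 cM]] := underdetermined_system
  (\matrix_(p < k.+1, q < k') a (w p) (u q)) (k'k : (k' < k.+1)%N).
have [v_gt0 lv] := wP _ c0.
rewrite -(ler_pM2r v_gt0); apply: le_trans lv _; apply: (eigenbasis_max ub).
  exact: (si_sum aV).
move=> i ik; rewrite (si_suml aV)//; last exact: Vu.
by rewrite -[RHS](cM (Ordinal ik)); apply: eq_bigr => p _; rewrite mxE.
Qed.

End Spectrum.

(** * Gram matrices, and sequences of mesh sizes *)

Section QuadraticForms.
Variables (R : realType) (E : lmodType R) (a : E -> E -> R) (V : set E).
Hypothesis aV : semi_inner a V.

Lemma si_square n (c : 'I_n -> R) (w : 'I_n -> E) : (forall i, V (w i)) ->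
  let v := \sum_i c i *: w i in a v v = \sum_i \sum_j c i * c j * a (w i) (w j).
Proof.
move=> Vw v; rewrite /v (si_suml aV)//; last exact: (si_sum aV).
apply: eq_bigr => i _; rewrite (si_sumr aV)// mulr_sumr.
by apply: eq_bigr => j _; rewrite mulrA.
Qed.

Lemma diagonal_sum n (c d : 'I_n -> R) :
  \sum_i \sum_j c i * c j * (d i * (i == j)%:R) = \sum_i c i ^+ 2 * d i.
Proof.
apply: eq_bigr => i _; rewrite (bigD1 i)//= eqxx mulr1 big1 ?addr0 ?expr2//.
by move=> j ji; rewrite eq_sym (negbTE ji) !mulr0.
Qed.

Lemma si_square_orth n (c : 'I_n -> R) (w : 'I_n -> E) : (forall i, V (w i)) ->
  (forall i j, i != j -> a (w i) (w j) = 0) ->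
  let v := \sum_i c i *: w i in a v v = \sum_i c i ^+ 2 * a (w i) (w i).
Proof.
move=> Vw ww v; rewrite /v si_square// -diagonal_sum.
apply: eq_bigr => i _; apply: eq_bigr => j _.
by have [->|ij] := eqVneq i j; [rewrite mulr1|rewrite ww// !mulr0].
Qed.

(** A Gram matrix entrywise within e of diag(d) differs from it as a quadratic
    form by at most e n |c|^2, because |c_i c_j| <= (c_i^2 + c_j^2) / 2. *)
Lemma si_square_near n (c d : 'I_n -> R) (w : 'I_n -> E) e : (forall i, V (w i)) ->
  (forall i j, `|a (w i) (w j) - d i * (i == j)%:R| <= e) ->
  `|a (\sum_i c i *: w i) (\sum_i c i *: w i) - \sum_i c i ^+ 2 * d i| <= e * n%:R * \sum_i c i ^+ 2.
Proof.
move=> Vw we; rewrite si_square// -diagonal_sum -sumrB.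
have -> : e * n%:R * \sum_i c i ^+ 2 =
    \sum_(i < n) \sum_(j < n) (c i ^+ 2 + c j ^+ 2) / 2 * e.
  have inner i : \sum_(j < n) (c i ^+ 2 + c j ^+ 2) / 2 * e =
      c i ^+ 2 * (n%:R / 2 * e) + (\sum_j c j ^+ 2) / 2 * e.
    rewrite -!big_distrl/= big_split/= sumr_const card_ord -mulr_natr.
    by ring.
  rewrite [RHS](eq_bigr _ (fun i _ => inner i)).
  rewrite big_split/= -big_distrl/= sumr_const card_ord -mulr_natr.
  by field.
apply: le_trans (ler_norm_sum _ _ _) _; apply: ler_sum => i _.
rewrite -sumrB; apply: le_trans (ler_norm_sum _ _ _) _; apply: ler_sum => j _.
rewrite -mulrBr normrM; apply: ler_pM => //.
have := sqr_ge0 (`|c i| - `|c j|); rewrite normrM.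
rewrite -(real_normK (num_real (c i))) -(real_normK (num_real (c j))).
by move=> ?; lra.
Qed.

Lemma sum_sqr_gt0 n (c : 'I_n -> R) : (exists i, c i != 0) -> 0 < \sum_i c i ^+ 2.
Proof.
move=> [i ci]; rewrite (bigD1 i)//=; apply: ltr_pwDl.
  by rewrite lt_neqAle eq_sym sqrf_eq0 ci sqr_ge0.
by apply: sumr_ge0 => j _; exact: sqr_ge0.
Qed.

End QuadraticForms.

Section SequencesToZero.
Variable R : realType.

(** Strict decrease makes the sequence injective, so that a sequence of vectors
    indexed by n defines a family indexed by h, and it is inherited by
    subsequences. *)
Record null_seq (hs : nat -> R) : Prop := NullSeq {
  null_seq_itv : forall n, 0 < hs n <= 1;
  null_seq_decr : forall n, hs n.+1 < hs n;
  null_seq_cvg : hs n @[n --> \oo] --> (0 : R) }.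

Lemma null_seq_lt hs i j : null_seq hs -> (i < j)%N -> hs j < hs i.
Proof.
move=> hs0; elim: j => // j IH; rewrite ltnS leq_eqVlt => /predU1P[->|/IH].
  exact: null_seq_decr.
exact: (lt_trans (null_seq_decr hs0 j)).
Qed.

Lemma null_seq_sub hs s : null_seq hs -> increasing_index s ->
  null_seq (fun n => hs (s n)).
Proof.
move=> hs0 si; split => [n|n|]; first exact: null_seq_itv.
  exact: null_seq_lt.
exact: (cvg_subseq_index si (null_seq_cvg hs0)).
Qed.

Lemma null_seq_lim hs (f : R -> R) (l : R) : null_seq hs ->
  f h @[h --> 0^'+] --> l -> f (hs n) @[n --> \oo] --> l.
Proof.
move=> hs0 /cvg_at_rightP; apply; split; last exact: null_seq_cvg.
by move=> n; have /andP[] := null_seq_itv hs0 n.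
Qed.

(** Claims for all sufficiently small h are refuted along sequences. *)
Lemma not_near_null_seq (P : R -> Prop) : ~ (\forall h \near 0^'+, P h) ->
  exists2 hs, null_seq hs & forall n, ~ P (hs n).
Proof.
move=> nP.
have ex e : exists h, 0 < e -> [/\ 0 < h, h < e & ~ P h].
  have [e0|e0] := pselect (0 < e); last by exists 0.
  apply: contrapT => nh; apply: nP; near=> h; apply: contrapT => nPh; apply: nh.
  exists h => _; split => //.
have [f fP] := choice ex.
pose hs := fix hs n := f (if n is m.+1 then Num.min (hs m) (m.+2%:R^-1) else 1).
have hs_gt0 n : 0 < hs n.
  elim: n => [|n IH] /=; first by case: (fP 1).
  have m_gt0 : 0 < Num.min (hs n) n.+2%:R^-1 by rewrite lt_min IH/= invr_gt0.
  by case: (fP _ m_gt0).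
have m_gt0 n : 0 < Num.min (hs n) n.+2%:R^-1 by rewrite lt_min hs_gt0/= invr_gt0.
have hs_decr n : hs n.+1 < hs n.
  by have [_ + _] := fP _ (m_gt0 n); rewrite lt_min => /andP[].
have hs_harm n : hs n <= n.+1%:R^-1.
  case: n => [|n] /=; first by rewrite invr1; case: (fP _ (@ltr01 R)) => _ /ltW.
  by have [_ + _] := fP _ (m_gt0 n); rewrite lt_min => /andP[_ /ltW].
exists hs.
  split => // [n|].
    rewrite hs_gt0/=; apply: le_trans (hs_harm n) _.
    by rewrite invf_le1// ler1n.
  apply: (@cvg0_squeeze _ _ _ _ _ harmonic); last exact: cvg_harmonic.
  by move=> n; rewrite (ltW (hs_gt0 n)) hs_harm.
case=> [|n]; first by case: (fP 1).
by case: (fP _ (m_gt0 n)).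
Unshelve. all: by end_near. Qed.

End SequencesToZero.

(** * Spectral convergence in varying spaces *)

Section SpectralConvergence.
Variables (R : realType) (E : lmodType R) (a : E -> E -> R).
Variables (H : set E) (W : R -> set E) (T : E -> E) (Th Rh : R -> E -> E).
Variables (mu : nat -> R) (muh : R -> nat -> R).
Implicit Types (u v w : E) (h : R).
Hypothesis aH : semi_inner a H.
Hypothesis aW : forall h, 0 < h <= 1 -> semi_inner a (W h).
Hypothesis TH : compact_positive_op a H T.
Hypothesis ThW : forall h, 0 < h <= 1 -> compact_positive_op a (W h) (Th h).
Hypothesis mu_eig : eigenvalue_sequence a H T mu.
Hypothesis muh_eig : forall h, 0 < h <= 1 ->
  eigenvalue_sequence a (W h) (Th h) (muh h).
Hypothesis Rh_lin : forall h, 0 < h <= 1 ->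
  maps H (W h) (Rh h) /\ linear_op a H (Rh h).
Hypothesis Rh_bounded : exists c0, forall h, 0 < h <= 1 -> bounded_op a H c0 (Rh h).
Hypothesis inner_cvg : forall (uh vh : R -> E) u v,
  (forall h, 0 < h <= 1 -> W h (uh h) /\ W h (vh h)) -> H u -> H v ->
  anorm a (uh h - Rh h u) @[h --> 0^'+] --> (0 : R) ->
  anorm a (vh h - Rh h v) @[h --> 0^'+] --> (0 : R) ->
  a (uh h) (vh h) @[h --> 0^'+] --> a u v.
Hypothesis Th_bounded : exists C, forall h, 0 < h <= 1 ->
  bounded_op a (W h) C (Th h).
Hypothesis Th_cvg : forall (psih : R -> E) psi,
  (forall h, 0 < h <= 1 -> W h (psih h)) -> H psi ->
  anorm a (psih h - Rh h psi) @[h --> 0^'+] --> (0 : R) ->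
  anorm a (Th h (psih h) - Rh h (T psi)) @[h --> 0^'+] --> (0 : R).
Hypothesis Th_compact : forall (hs : nat -> R) (psi : nat -> E),
  (forall n, 0 < hs n <= 1) -> hs n @[n --> \oo] --> (0 : R) ->
  (forall n, W (hs n) (psi n)) -> (exists C, forall n, anorm a (psi n) <= C) ->
  exists2 s, increasing_index s &
  exists2 u, H u &
    anorm a (Th (hs (s n)) (psi (s n)) - Rh (hs (s n)) u) @[n --> \oo] --> (0 : R).

Lemma Rh_maps h : 0 < h <= 1 -> maps H (W h) (Rh h).
Proof. by move=> /Rh_lin[]. Qed.
Let Tm := cpop_maps TH.
Lemma Th_maps h : 0 < h <= 1 -> maps (W h) (W h) (Th h).
Proof. by move=> /ThW[]. Qed.

Lemma anorm0 : anorm a 0 = 0.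
Proof. by rewrite /anorm (si_0l aH) ?sqrtr0//; exact: (si_0 aH). Qed.

(** Convergence of x_n in W (hs n) to u in H, measured through the interpolation
    operators. *)
Definition disc_cvg (hs : nat -> R) (x : nat -> E) u :=
  [/\ forall n, W (hs n) (x n), H u &
      anorm a (x n - Rh (hs n) u) @[n --> \oo] --> (0 : R)].

(** Conditions I and III speak of families indexed by all h in (0, 1].  A
    sequence converging to u is completed to such a family by the vectors R_h u
    at the mesh sizes that it misses. *)
Lemma disc_cvg_family hs x u : null_seq hs -> disc_cvg hs x u ->
  exists xf : R -> E, [/\ forall h, 0 < h <= 1 -> W h (xf h),
    forall n, xf (hs n) = x n &
    anorm a (xf h - Rh h u) @[h --> 0^'+] --> (0 : R)].
Proof.
move=> hs0 [Wx Hu xu].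
have hs_inj : injective hs.
  move=> i j ij; case: (ltngtP i j) => // /(null_seq_lt hs0).
    by rewrite ij ltxx.
  by rewrite ij ltxx.
have ex h : exists y, (forall n, h = hs n -> y = x n) /\
    ((forall n, h <> hs n) -> y = Rh h u).
  have [[n ->]|nh] := pselect (exists n, h = hs n).
    exists (x n); split=> [m /hs_inj ->//|/(_ n)//].
  by exists (Rh h u); split=> // n hn; exfalso; apply: nh; exists n.
have [xf xfP] := choice ex; exists xf; split.
- move=> h h1; have [xf1 xf2] := xfP h.
  have [[n hn]|nh] := pselect (exists n, h = hs n).
    by rewrite (xf1 _ hn) hn.
  by rewrite xf2; [exact: Rh_maps|move=> n hn; apply: nh; exists n].
- by move=> n; have [xf1 _] := xfP (hs n); exact: xf1.
- apply/cvgr0Pnorm_lt => e e0.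
  move/cvgr0Pnorm_lt : xu => /(_ _ e0)[N _ xN].
  have hsN : 0 < hs N by have /andP[] := null_seq_itv hs0 N.
  near=> h; have [xf1 xf2] := xfP h.
  have [[n hn]|nh] := pselect (exists n, h = hs n).
    rewrite (xf1 _ hn) hn; apply: xN => /=.
    rewrite leqNgt; apply/negP => /(null_seq_lt hs0); rewrite -hn.
    apply/negP; rewrite -leNgt; near: h; exact: nbhs_right_ltW.
  rewrite xf2; last by move=> n hn; apply: nh; exists n.
  by rewrite subrr anorm0 normr0.
Unshelve. all: by end_near. Qed.

Lemma disc_cvg_inner hs x y u v : null_seq hs ->
  disc_cvg hs x u -> disc_cvg hs y v ->
  a (x n) (y n) @[n --> \oo] --> a u v.
Proof.
move=> hs0 xu yv; have [_ Hu _] := xu; have [_ Hv _] := yv.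
have [xf [Wxf xfE xfu]] := disc_cvg_family hs0 xu.
have [yf [Wyf yfE yfv]] := disc_cvg_family hs0 yv.
have lim := inner_cvg (fun h p => conj (Wxf h p) (Wyf h p)) Hu Hv xfu yfv.
have := null_seq_lim hs0 lim.
by under eq_fun do rewrite xfE yfE.
Qed.

Lemma disc_cvg_op hs x u : null_seq hs -> disc_cvg hs x u ->
  disc_cvg hs (fun n => Th (hs n) (x n)) (T u).
Proof.
move=> hs0 xu; have [Wx Hu _] := xu.
have [xf [Wxf xfE xfu]] := disc_cvg_family hs0 xu.
split; [by move=> n; apply: (Th_maps (null_seq_itv hs0 n)) |exact: Tm|].
have := null_seq_lim hs0 (Th_cvg Wxf Hu xfu).
by under eq_fun do rewrite xfE.
Qed.

Lemma disc_cvg_sub hs x u s : increasing_index s -> disc_cvg hs x u ->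
  disc_cvg (fun n => hs (s n)) (fun n => x (s n)) u.
Proof. by move=> si [Wx Hu xu]; split => //; exact: (cvg_subseq_index si xu). Qed.

Lemma disc_cvg_interp hs u : null_seq hs -> H u ->
  disc_cvg hs (fun n => Rh (hs n) u) u.
Proof.
move=> hs0 Hu; split => // [n|]; first exact: (Rh_maps (null_seq_itv hs0 n)).
by under eq_fun do rewrite subrr anorm0; exact: cvg_cst.
Qed.

(** Condition IV for finitely many sequences at once, by successive extraction. *)
Lemma disc_compact m hs (x : nat -> nat -> E) : null_seq hs ->
  (forall i n, (i < m)%N -> W (hs n) (x i n) /\ anorm a (x i n) = 1) ->
  exists2 s, increasing_index s & exists w : nat -> E, forall i, (i < m)%N ->
    disc_cvg (fun n => hs (s n)) (fun n => Th (hs (s n)) (x i (s n))) (w i).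
Proof.
move=> hs0; elim: m => [|m IH] xP.
  by exists id => //; exists (fun=> 0).
have [|s si [w wP]] := IH; first by move=> i n im; apply: xP; exact: ltnW.
have hss0 := null_seq_sub hs0 si.
have [||s' s'i [z Hz zP]] := Th_compact (psi := fun n => x m (s n))
    (null_seq_itv hss0) (null_seq_cvg hss0).
- by move=> n; case: (xP m (s n)).
- by exists 1 => n; case: (xP m (s n)) => // _ ->.
exists (s \o s'); first exact: increasing_index_comp.
exists (fun i => if (i < m)%N then w i else z) => i.
rewrite ltnS leq_eqVlt => /predU1P[->|im].
  rewrite ltnn; split => // n; apply: (Th_maps (null_seq_itv hs0 _)).
  by case: (xP m (s (s' n))).
by rewrite im; exact: (disc_cvg_sub s'i (wP i im)).
Qed.

(** The Gram matrices of the images T_h u_i.  These, rather than the u_i, are the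
    vectors to which condition IV gives a limit. *)
Lemma Th_eigenvectors_inner h k (u : nat -> E) i j : 0 < h <= 1 ->
  eigenbasis a (W h) (Th h) (muh h) k u -> (i < k)%N -> (j < k)%N ->
  a (Th h (u i)) (Th h (u j)) = muh h i * muh h j * (i == j)%:R /\
  a (Th h (Th h (u i))) (Th h (u j)) = muh h i * muh h i * muh h j * (i == j)%:R.
Proof.
move=> hi [Eu uu] ik jk; have aWh := aW hi; have Sh := ThW hi.
have Wi : W h (u i) by case: (Eu _ ik).
have Wj : W h (u j) by case: (Eu _ jk).
have WTi := Th_maps hi Wi; have WTj := Th_maps hi Wj; have WTTj := Th_maps hi WTj.
have e1 : a (Th h (u i)) (Th h (u j)) = muh h i * muh h j * (i == j)%:R.
  rewrite (eigen_inner aWh Sh (Eu _ ik))// (si_sym aWh)//.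
  by rewrite (eigen_inner aWh Sh (Eu _ jk))// uu// eq_sym mulrA.
split => //.
rewrite (cpop_sa Sh WTi WTj) (eigen_inner aWh Sh (Eu _ ik))//.
rewrite -(cpop_sa Sh Wi WTj) e1.
by ring.
Qed.

(** The limits w_i of the T_h u_i are orthogonal, also for a(T ., .), and
    a(T w_i, w_i) is the limit of muh_i^3 while a(w_i, w_i) is that of muh_i^2.
    If muh_i >= lambda for all i <= k along the sequence, the w_i span a
    (k+1)-dimensional space where the Rayleigh quotient of T is at least
    lambda. *)
Lemma muh_lt_near k e : 0 < e -> \forall h \near 0^'+, muh h k < mu k + e.
Proof.
move=> e_gt0; apply: contrapT => /not_near_null_seq[hs hs0 hsP].
set lambda := mu k + e in hsP.
have mu_ge0 : 0 <= mu k by case: mu_eig.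
have lambda_gt0 : 0 < lambda by rewrite /lambda; lra.
have hs1 n := null_seq_itv hs0 n.
have large n i : (i < k.+1)%N -> lambda <= muh (hs n) i.
  move=> ik; apply: (@le_trans _ _ (muh (hs n) k)).
    by rewrite leNgt; apply/negP; exact: hsP.
  exact: (mu_nonincr (muh_eig (hs1 n))).
have /choice[u ub] n : exists u : nat -> E,
    eigenbasis a (W (hs n)) (Th (hs n)) (muh (hs n)) k.+1 u.
  apply: (eigenbasis_exists (aW (hs1 n)) (ThW (hs1 n)) (muh_eig (hs1 n))) => i ik.
  exact: lt_le_trans (large n i ik).
have [|s si [w wP]] := @disc_compact k.+1 hs (fun i n => u n i) hs0.
  move=> i n ik; have [Eu uu] := ub n; split; first by case: (Eu _ ik).
  by rewrite /anorm uu// eqxx sqrtr1.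
have hss0 := null_seq_sub hs0 si.
have Hw i : (i < k.+1)%N -> H (w i) by move=> /wP[].
have lim1 i j ik jk := disc_cvg_inner hss0 (wP i ik) (wP j jk).
have lim2 i j ik jk :=
  disc_cvg_inner hss0 (disc_cvg_op hss0 (wP i ik)) (wP j jk).
have orth i j : (i < k.+1)%N -> (j < k.+1)%N -> i != j ->
    a (w i) (w j) = 0 /\ a (T (w i)) (w j) = 0.
  move=> ik jk ij; have := lim1 i j ik jk; have := lim2 i j ik jk.
  have val n := Th_eigenvectors_inner (hs1 (s n)) (ub (s n)) ik jk.
  under eq_fun do rewrite (val _).2 (negbTE ij) mulr0.
  move=> /(cvg_unique (@norm_hausdorff _ _)) T0.
  under eq_fun do rewrite (val _).1 (negbTE ij) mulr0.
  move=> /(cvg_unique (@norm_hausdorff _ _)) w0.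
  by split; [apply: w0|apply: T0]; exact: cvg_cst.
have diag i : (i < k.+1)%N -> 0 < a (w i) (w i) /\
    lambda * a (w i) (w i) <= a (T (w i)) (w i).
  move=> ik; have := lim1 i i ik ik; have := lim2 i i ik ik.
  have val n := Th_eigenvectors_inner (hs1 (s n)) (ub (s n)) ik ik.
  under eq_fun do rewrite (val _).2 eqxx mulr1.
  move=> l2; under eq_fun do rewrite (val _).1 eqxx mulr1; move=> l1; split.
    apply: (@lt_le_trans _ _ (lambda * lambda)); first by rewrite mulr_gt0.
    apply: (cvgr_to_ge l1); near=> n.
    by apply: ler_pM; rewrite ?(ltW lambda_gt0)// large.
  apply: (ler_cvg_to (cvgMl_tmp (a := lambda) l1) l2); near=> n.
  rewrite mulrA; apply: ler_wpM2r; first exact: le_trans (ltW lambda_gt0) (large _ _ ik).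
  apply: ler_wpM2r; last exact: large.
  exact: le_trans (ltW lambda_gt0) (large _ _ ik).
(* The max-min principle for T now contradicts lambda = mu k + e. *)
suff : lambda <= mu k by rewrite leNgt => /negP; apply; rewrite /lambda ltrDl.
have Hw' (i : 'I_k.+1) : H (w i) by exact: Hw.
apply: (courant_fischer aH TH mu_eig Hw') => c c0 v.
have -> : a v v = \sum_i c i ^+ 2 * a (w i) (w i).
  by rewrite (si_square_orth aH)// => i j ij; case: (orth i j _ _ ij).
have -> : a (T v) v = \sum_i c i ^+ 2 * a (T (w i)) (w i).
  rewrite (si_square_orth (cpop_semi_inner aH TH))// => i j ij.
  by case: (orth i j _ _ ij).
split; last first.
  rewrite mulr_sumr; apply: ler_sum => i _; rewrite mulrCA ler_wpM2l ?sqr_ge0//.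
  by have [] := diag i (ltn_ord i).
have [i0 ci0] := c0; rewrite (bigD1 i0)//=; apply: ltr_pwDl.
  rewrite mulr_gt0//; last by have [] := diag i0 (ltn_ord i0).
  by rewrite lt_neqAle eq_sym sqrf_eq0 ci0 sqr_ge0.
apply: sumr_ge0 => i _; rewrite mulr_ge0 ?sqr_ge0//.
by have [/ltW] := diag i (ltn_ord i).
Unshelve. all: by end_near. Qed.

(** The span of the R_h u_i is an admissible space for max-min: the Gram
    matrices of these vectors are close to the identity and to
    diag(mu_0, ..., mu_k). *)
Lemma muh_gt_near k e : 0 < e -> \forall h \near 0^'+, mu k - e < muh h k.
Proof.
move=> e_gt0.
have near1 : \forall h \near (0 : R)^'+, 0 < h <= 1.
  by near=> h; apply/andP; split => //; near: h; exact: nbhs_right_ltW.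
have muh_ge0 h : 0 < h <= 1 -> 0 <= muh h k by move=> /muh_eig[].
have [neg|pos] := ltP (mu k - e) 0.
  by near=> h; apply: (lt_le_trans neg); apply: muh_ge0; near: h.
have mu_gt0 : 0 < mu k by lra.
have [u [Eu uu]] : exists u : nat -> E, eigenbasis a H T mu k.+1 u.
  apply: (eigenbasis_exists aH TH mu_eig) => i ik; apply: lt_le_trans mu_gt0 _.
  exact: (mu_nonincr mu_eig).
have Hu (i : 'I_k.+1) : H (u i) by case: (Eu i (ltn_ord i)).
(* With delta = (k + 1) d the Rayleigh quotient on the span is at least
   (mu k - delta) / (1 + delta), and this is at least mu k - e / 2 because
   delta (mu k + 1) = e / 2. *)
pose d := e / 2 / (mu k + 1) / k.+1%:R.
have mu1 : 0 < mu k + 1 by lra.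
have d_gt0 : 0 < d by rewrite !divr_gt0.
have WR h v : 0 < h <= 1 -> H v -> W h (Rh h v) by move=> h01; apply: Rh_maps.
have Rcvg v : anorm a (Rh h v - Rh h v) @[h --> 0^'+] --> (0 : R).
  by under eq_fun do rewrite subrr anorm0; exact: cvg_cst.
have lim1 (i j : 'I_k.+1) :
    a (Rh h (u i)) (Rh h (u j)) @[h --> 0^'+] --> (1 * (i == j)%:R : R).
  have -> : 1 * (i == j)%:R = a (u i) (u j) by rewrite mul1r uu.
  by apply: inner_cvg => // h h01; split; exact: WR.
have lim2 (i j : 'I_k.+1) :
    a (Th h (Rh h (u i))) (Rh h (u j)) @[h --> 0^'+] --> (mu i * (i == j)%:R : R).
  have -> : mu i * (i == j)%:R = a (T (u i)) (u j).
    by rewrite (eigen_inner aH TH (Eu _ (ltn_ord i)))// uu.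
  apply: inner_cvg => //; [|exact: Tm|].
    by move=> h h01; split; [apply: (Th_maps h01); exact: WR|exact: WR].
  by apply: Th_cvg => // h h01; exact: WR.
have near_gram (A : R -> 'I_k.+1 -> 'I_k.+1 -> R) (l : 'I_k.+1 -> 'I_k.+1 -> R) :
    (forall i j, A h i j @[h --> 0^'+] --> l i j) ->
    \forall h \near 0^'+, forall i j, `|A h i j - l i j| <= d.
  move=> Al; apply: filter_forall => i; apply: filter_forall => j.
  move/cvgrPdist_le : (Al i j) => /(_ _ d_gt0).
  by under eq_near do rewrite distrC.
have near_lim1 := near_gram _ _ lim1; have near_lim2 := near_gram _ _ lim2.
near=> h.
have h01 : 0 < h <= 1 by near: h.
have gram1 : forall i j : 'I_k.+1,
    `|a (Rh h (u i)) (Rh h (u j)) - 1 * (i == j)%:R| <= d by near: h.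
have gram2 : forall i j : 'I_k.+1,
    `|a (Th h (Rh h (u i))) (Rh h (u j)) - mu i * (i == j)%:R| <= d by near: h.
have aWh := aW h01; have Sh := ThW h01.
have WRu (i : 'I_k.+1) : W h (Rh h (u i)) by exact: WR.
apply: (@lt_le_trans _ _ (mu k - e / 2)); first by lra.
apply: (courant_fischer aWh Sh (muh_eig h01) WRu) => c c0 v.
have := si_square_near aWh c WRu gram1; rewrite -/v.
have := si_square_near (cpop_semi_inner aWh Sh) c WRu gram2; rewrite -/v.
under [X in _ -> `|_ - X| <= _ -> _]eq_bigr do rewrite mulr1.
have C_gt0 := sum_sqr_gt0 c0.
have : mu k * (\sum_i c i ^+ 2) <= \sum_i c i ^+ 2 * mu i.
  rewrite mulr_sumr; apply: ler_sum => i _; rewrite mulrC ler_wpM2l ?sqr_ge0//.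
  by apply: (mu_nonincr mu_eig); rewrite -ltnS.
have dk : d * k.+1%:R * (mu k + 1) = e / 2.
  by rewrite /d; field; rewrite (gt_eqF mu1) nat1r pnatr_eq0.
have delta_gt0 : 0 < d * k.+1%:R by rewrite mulr_gt0.
set delta := d * k.+1%:R in dk delta_gt0 *.
set C := \sum_i c i ^+ 2 in C_gt0 *; set Z := \sum_i _.
move=> muC; rewrite !ler_norml => /andP[lowT _] /andP[lowG uppG].
have delta_lt1 : delta < 1 by nra.
have lowG' : 0 < (1 - delta) * C by apply: mulr_gt0 => //; lra.
split; first by lra.
have coef : (mu k - e / 2) * (1 + delta) <= mu k - delta by nra.
have : (mu k - e / 2) * a v v <= (mu k - e / 2) * ((1 + delta) * C).
  by apply: ler_wpM2l; lra.
have : (mu k - e / 2) * (1 + delta) * C <= (mu k - delta) * C.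
  by apply: ler_wpM2r => //; lra.
lra.
Unshelve. all: by end_near. Qed.

Lemma muh_cvg k : muh h k @[h --> 0^'+] --> mu k.
Proof.
apply/cvgrPdist_lt => e e0; near=> h.
have lower : mu k - e < muh h k by near: h; exact: muh_gt_near.
have upper : muh h k < mu k + e by near: h; exact: muh_lt_near.
by rewrite ltr_norml; apply/andP; split; lra.
Unshelve. all: by end_near. Qed.

Definition eigen_consistency h k := [set r | exists u,
  [/\ eigen_space a H T (mu k) u, anorm a u = 1 &
      r = anorm a (Th h (Rh h u) - Rh h (T u))]].

(** T u and lambda u are at distance zero; linear and bounded, R_h keeps them so. *)
Lemma Rh_eigen h lambda u : 0 < h <= 1 -> eigen_space a H T lambda u ->
  forall x, W h x -> a (Rh h (T u)) x = lambda * a (Rh h u) x.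
Proof.
move=> h01 [Hu Tu] x Wx; have aWh := aW h01.
have [c0 /(_ _ h01) Rb] := Rh_bounded; have [_ /(_ lambda u (T u - lambda *: u))] := Rh_lin h01.
have HTu := Tm Hu; have Hd : H (T u - lambda *: u).
  by apply: (si_B aH) => //; exact: (si_Z aH).
move=> /(_ Hu Hd); rewrite addrC subrK => Rl.
have WRTu := Rh_maps h01 HTu; have WRu := Rh_maps h01 Hu; have WRd := Rh_maps h01 Hd.
have Wl := si_closed aWh lambda WRu WRd.
rewrite (proj1 (aeqP aWh WRTu Wl) Rl)// (si_linl aWh)//.
suff -> : a (Rh h (T u - lambda *: u)) x = 0 by rewrite addr0.
have d0 : anorm a (Rh h (T u - lambda *: u)) = 0.
  apply/eqP; rewrite eq_le anorm_ge0 andbT.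
  by have := Rb _ Hd; rewrite Tu mulr0.
apply/eqP; rewrite -normr_le0.
by have := cauchy_schwarz aWh WRd Wx; rewrite d0 mul0r.
Qed.

(** Without an upper bound the real supremum would carry no information. *)
Lemma eigen_consistency_bounded h k : 0 < h <= 1 -> has_ubound (eigen_consistency h k).
Proof.
move=> h01; have [c0 /(_ _ h01) Rb] := Rh_bounded; have [C /(_ _ h01) Tb] := Th_bounded.
have aWh := aW h01.
exists (`|C| * `|c0| + `|c0| * mu k) => _ [u [[Hu Tu] u1 ->]].
have HTu := Tm Hu; have WRu := Rh_maps h01 Hu; have WRTu := Rh_maps h01 HTu.
have WTRu := Th_maps h01 WRu.
have mu_ge0 : 0 <= mu k by case: mu_eig.
have Tu1 : anorm a (T u) = mu k.
  rewrite (aeq_anorm aH HTu (si_Z aH (mu k) Hu) Tu) (anormZ aH)// u1 mulr1.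
  by rewrite ger0_norm.
have R1 : anorm a (Rh h u) <= `|c0|.
  by apply: le_trans (Rb _ Hu) _; rewrite u1 mulr1 ler_norm.
have R2 : anorm a (Rh h (T u)) <= `|c0| * mu k.
  apply: le_trans (Rb _ HTu) _; rewrite Tu1; apply: ler_wpM2r => //.
  exact: ler_norm.
have T1 : anorm a (Th h (Rh h u)) <= `|C| * `|c0|.
  apply: le_trans (Tb _ WRu) _.
  apply: (@le_trans _ _ (`|C| * anorm a (Rh h u))).
    by apply: ler_wpM2r; [exact: anorm_ge0|exact: ler_norm].
  exact: ler_wpM2l.
apply: le_trans (lerD T1 R2).
have W0 := si_0 aWh.
by have := anorm_tri aWh WTRu W0 WRTu; rewrite subr0 sub0r (anormN aWh).
Qed.

(** For unit vectors x and u with T_h x = muh_k x and T u = mu_k u,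
    a(T_h R_h u - R_h T u, x) = (muh_k - mu_k) a(R_h u, x).  Along a sequence
    violating the bound, the eigenvectors x have a limit in the sense of
    [disc_cvg], which supplies a u with a(R_h u, x) -> 1; the factor 2 absorbs
    the requirement a(R_h u, x) > 1/2. *)
Lemma muh_error k : 0 < mu k -> \forall h \near 0^'+,
  `|muh h k - mu k| <= 2 * sup (eigen_consistency h k).
Proof.
move=> mu_gt0.
have muh_pos : \forall h \near 0^'+, 0 < muh h k.
  by have := muh_gt_near k mu_gt0; under eq_near do rewrite subrr.
suff : \forall h \near 0^'+, 0 < muh h k ->
    `|muh h k - mu k| <= 2 * sup (eigen_consistency h k).
  by move=> near_imp; apply: filterS2 muh_pos near_imp => h p; exact.
apply: contrapT => /not_near_null_seq[hs hs0 hsP].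
have hs1 n := null_seq_itv hs0 n.
have muhn n : 0 < muh (hs n) k.
  by rewrite ltNge; apply/negP => neg; apply: (hsP n); rewrite ltNge neg.
have bad n : 2 * sup (eigen_consistency (hs n) k) < `|muh (hs n) k - mu k|.
  by rewrite ltNge; apply/negP => ok; apply: (hsP n).
have /choice[x xP] n : exists x, eigen_space a (W (hs n)) (Th (hs n)) (muh (hs n) k) x
    /\ anorm a x = 1.
  have [|u [Eu uu]] := @eigenbasis_exists _ _ _ _ _ _ (aW (hs1 n)) (ThW (hs1 n)) (muh_eig (hs1 n)) k.+1.
    move=> i ik; apply: lt_le_trans (muhn n) _.
    exact: (mu_nonincr (muh_eig (hs1 n))).
  by exists (u k); split; [exact: Eu|rewrite /anorm uu// eqxx sqrtr1].
have [|s si [w0 w0P]] := @disc_compact 1 hs (fun _ n => x n) hs0.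
  by move=> i n _; have [[Wx _] x1] := xP n.
have xw := w0P 0%N (ltnSn 0); set w := w0 0%N in xw.
have [_ Hw _] := xw.
have hss0 := null_seq_sub hs0 si; pose m n := muh (hs (s n)) k.
have m_cvg : m n @[n --> \oo] --> mu k by have := null_seq_lim hss0 (muh_cvg (k := k)).
have TTw := disc_cvg_op hss0 xw.
have inner_T n z : W (hs (s n)) z ->
    a (Th (hs (s n)) (x (s n))) z = m n * a (x (s n)) z.
  move=> Wz; have [Ex _] := xP (s n).
  by rewrite (eigen_inner (aW (hs1 (s n))) (ThW (hs1 (s n))) Ex).
have Wx n : W (hs n) (x n) by have [[]] := xP n.
have xx n : a (x n) (x n) = 1.
  by rewrite -(sqr_anorm (aW (hs1 n)))// (xP n).2 expr1n.
have WTx n : W (hs (s n)) (Th (hs (s n)) (x (s n))) by exact: (Th_maps (hs1 _)).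
have WTTx n : W (hs (s n)) (Th (hs (s n)) (Th (hs (s n)) (x (s n)))).
  exact: (Th_maps (hs1 _)).
have xT n z : W (hs (s n)) z ->
    a (x (s n)) (Th (hs (s n)) z) = m n * a (x (s n)) z.
  by move=> Wz; rewrite -(cpop_sa (ThW (hs1 (s n))))// inner_T.
have inner_TT n z : W (hs (s n)) z ->
    a (Th (hs (s n)) (Th (hs (s n)) (x (s n)))) z = m n * (m n * a (x (s n)) z).
  move=> Wz; have WTz := Th_maps (hs1 (s n)) Wz.
  by rewrite (cpop_sa (ThW (hs1 (s n))) (WTx n) Wz) inner_T// xT.
(* The limit w of T_h x is an eigenvector: with the three inner products below,
   |T w - mu w|^2 = mu^4 - 2 mu mu^3 + mu^2 mu^2 = 0. *)
have gram11 : a w w = mu k * mu k.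
  have := disc_cvg_inner hss0 xw xw.
  under eq_fun do rewrite inner_T// xT// xx mulr1.
  by move=> /(cvg_unique (@norm_hausdorff _ _)); apply; exact: cvgM.
have gram21 : a (T w) w = mu k * (mu k * mu k).
  have := disc_cvg_inner hss0 TTw xw.
  under eq_fun do rewrite inner_TT// xT// xx mulr1.
  move=> /(cvg_unique (@norm_hausdorff _ _)); apply; apply: cvgM => //.
  exact: cvgM.
have gram22 : a (T w) (T w) = mu k * (mu k * (mu k * mu k)).
  have := disc_cvg_inner hss0 TTw TTw.
  under eq_fun do rewrite inner_TT// !xT// xx mulr1.
  move=> /(cvg_unique (@norm_hausdorff _ _)); apply; apply: cvgM => //.
  by apply: cvgM => //; exact: cvgM.
have HTw := Tm Hw.
have Ew : eigen_space a H T (mu k) w.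
  split => //; rewrite /aeq /anorm.
  have Hmw := si_Z aH (mu k) Hw.
  rewrite (si_Bl aH)//; last exact: (si_B aH).
  rewrite !(si_Br aH)// !(si_Zr aH)// !(si_Zl aH)// (si_sym aH Hw HTw).
  rewrite gram11 gram21 gram22.
  by rewrite [X in Num.sqrt X](_ : _ = 0) ?sqrtr0//; ring.
pose u := (mu k)^-1 *: w.
have Hu : H u by exact: (si_Z aH).
have Eu : eigen_space a H T (mu k) u.
  have := eigen_space_sum aH TH (fun=> (mu k)^-1) (fun _ : 'I_1 => Ew).
  by rewrite big_ord1.
have u1 : anorm a u = 1.
  rewrite /u (anormZ aH)// /anorm gram11 -expr2 sqrtr_sqr -normrM mulVf ?normr1//.
  by rewrite gt_eqF.
have proj_cvg : m n * a (Rh (hs (s n)) u) (x (s n)) @[n --> \oo] --> mu k.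
  have -> : mu k = a u w by rewrite (si_Zl aH)// gram11 mulKf// gt_eqF.
  have := disc_cvg_inner hss0 (disc_cvg_interp hss0 Hu) xw.
  under eq_fun => n.
    have WRu := Rh_maps (hs1 (s n)) Hu.
    rewrite (si_sym (aW (hs1 (s n))) WRu (WTx n)) inner_T//.
    rewrite (si_sym (aW (hs1 (s n))) _ WRu)//.
    over.
  by [].
have half : 2^-1 < 1 :> R by rewrite invf_lt1// ltr1n.
have [n [m32 p34]] : exists n, m n < mu k * (3 / 2) /\
    mu k * (3 / 4) < m n * a (Rh (hs (s n)) u) (x (s n)).
  near \oo => n; exists n; split; near: n.
    by apply: (cvgr_lt _ m_cvg); lra.
  by apply: (cvgr_gt _ proj_cvg); lra.
have m_gt0 : 0 < m n by exact: muhn.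
(* m a(R_h u, x) > 3/4 mu and m < 3/2 mu. *)
have p12 : 2^-1 < a (Rh (hs (s n)) u) (x (s n)) by nra.
have h01 := hs1 (s n); set h := hs (s n) in h01 p12 *.
have := bad (s n); rewrite -/h; apply/negP; rewrite -leNgt.
have WRu := Rh_maps h01 Hu; have WRTu := Rh_maps h01 (Tm Hu); have WTRu := Th_maps h01 WRu.
have le_sup : anorm a (Th h (Rh h u) - Rh h (T u)) <= sup (eigen_consistency h k).
  have ub := eigen_consistency_bounded k h01.
  apply: sup_upper_bound; last by exists u.
  by split => //; exists (anorm a (Th h (Rh h u) - Rh h (T u))); exists u.
have [_ x1] := xP (s n); have Wxn : W h (x (s n)) by exact: Wx.
have := cauchy_schwarz (aW h01) (si_B (aW h01) WTRu WRTu) Wxn.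
rewrite x1 mulr1 (si_Bl (aW h01) WTRu WRTu Wxn) (Rh_eigen h01 Eu Wxn).
rewrite (cpop_sa (ThW h01) WRu Wxn) (si_sym (aW h01) WRu (Th_maps h01 Wxn)).
rewrite inner_T// (si_sym (aW h01) Wxn WRu) -mulrBl normrM.
rewrite (gtr0_norm (lt_trans _ p12)) ?invr_gt0// /m -/h.
have := normr_ge0 (muh h k - mu k).
nra.
Unshelve. all: by end_near. Qed.

End SpectralConvergence.

(** * Lebesgue measure on row vectors *)

Section OpenMeasurable.
Variables (R : realType) (d : nat).
Local Notation V := 'rV[R]_d.

Lemma measurable_box (l u : 'I_d -> R) :
  measurable [set x : V | forall i, l i < x ord0 i < u i].
Proof.
have -> : [set x : V | forall i, l i < x ord0 i < u i] =
    \bigcap_(i in [set: 'I_d]) (@coord R d i @^-1` `]l i, u i[%classic).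
  apply/seteqP; split=> x /= xlu i; first by move=> _ /=; rewrite in_itv/=.
  by have := xlu i I; rewrite /= in_itv.
apply: fin_bigcap_measurable; first exact: finite_finset.
move=> i _; rewrite -[X in measurable X]setTI.
by apply: measurable_coord => //; exact: measurable_itv.
Qed.

(** The measurable sets are generated by the coordinates; an open set is the
    countable union of the rational boxes that it contains. *)
Lemma open_measurable_rV (A : set V) : open A -> measurable A.
Proof.
move=> oA.
pose box (p : 'rV[rat]_d * nat) : set V :=
  [set x | forall i, ratr (p.1 ord0 i) - p.2.+1%:R^-1 < x ord0 i
                     < ratr (p.1 ord0 i) + p.2.+1%:R^-1].
pose F p := if `[< box p `<=` A >] then box p else set0.
have -> : A = \bigcup_p F p.
  apply/seteqP; split => [x Ax|x [p _]]; last first.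
    by rewrite /F; case: asboolP => // bA /bA.
  have /nbhs_ballP[e /= e0 xeA] : nbhs x A by exact: open_nbhs_nbhs.
  have [n ne] : exists n, n.+1%:R^-1 < e / 2.
    near \oo => n; exists n; near: n.
    by apply: (cvgr_lt _ (@cvg_harmonic R)); rewrite divr_gt0.
  have [h hE] : exists h : R, h = n.+1%:R^-1 by eexists.
  have h0 : 0 < h by rewrite hE invr_gt0.
  rewrite -hE in ne.
  have /choice[q qP] i : exists r : rat,
      ratr r \in `](x ord0 i - h), (x ord0 i + h)[.
    have /rat_in_itvoo[r] : x ord0 i - h < x ord0 i + h by lra.
    by exists r.
  exists (\row_i q i, n) => //.
  have xb : box (\row_i q i, n) x.
    move=> i /=; rewrite mxE -hE; have := qP i; rewrite in_itv/= => /andP[? ?].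
    by apply/andP; split; lra.
  rewrite /F; case: asboolP => // -[] y yb; apply: xeA; split => // i j.
  rewrite (ord1 i) /ball/= ltr_norml.
  have := yb j; have := xb j; rewrite /= mxE -hE => /andP[? ?] /andP[? ?].
  by apply/andP; split; lra.
apply: countable_bigcupT_measurable => // p.
by rewrite /F; case: asboolP => // _; exact: measurable_box.
Unshelve. all: by end_near. Qed.

Lemma continuous_open_measurable_fun (D : set V) (f : V -> R) : open D ->
  {in D, continuous f} -> measurable_fun D f.
Proof.
move=> oD /(continuous_inP _ oD) cf.
apply: (measurability _ (measurable_realfun.RGenOpens.measurableE R)).
move=> _ [_ [a [b ->] <-]]; apply: open_measurable_rV; apply: cf.
exact: interval_open.
Qed.

End OpenMeasurable.

Section FiniteMeasure.
Variable R : realType.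

(** Induction on d: a cube lies in the product of a cube and an interval. *)
Lemma leb_box_fin d (M : R) : (leb R d [set x : 'rV[R]_d | forall i, (- M < x ord0 i < M)%R] < +oo)%E.
Proof.
elim: d => [|d IH].
  by rewrite /= diracE; apply: (@le_lt_trans _ _ 1%E); rewrite ?ltry// lee_fin lern1; case: (_ \in _).
rewrite /= /pushforward.
have mB := measurable_box (fun _ : 'I_d => - M) (fun _ => M).
have : (@rV_snoc R d @^-1` [set x | forall i, - M < x ord0 i < M]) `<=`
    [set x : 'rV[R]_d | forall i, - M < x ord0 i < M] `*` `]-M, M[%classic.
  move=> [x t] /= xt; split.
    move=> /= i; have := xt (lift ord_max i).
    by rewrite mxE liftK.
  by have := xt ord_max; rewrite mxE unlift_none /= in_itv.
move=> sub; apply: (le_lt_trans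
  (@le_measure _ _ _ (leb R d \x lebesgue_measure)%E _ _ _ _ sub)).
- rewrite inE -[X in measurable X]setTI; 
  exact: (@measurable_rV_snoc R d measurableT _
    (measurable_box (fun=> - M) (fun=> M))).
- by rewrite inE; apply: measurableX => //; exact: measurable_itv.
- rewrite [ltLHS]product_measure1E//.
  have I_fin : (lebesgue_measure `](- M)%R, M[%classic < +oo :> \bar R)%E.
    by rewrite lebesgue_measure_itv/=; case: ifP => _; rewrite -?EFinD ltry.
  by apply: lte_mul_pinfty => //; rewrite ge0_fin_numE.
Qed.

Lemma leb_bounded_fin d (D : set 'rV[R]_d) : measurable D -> bounded_set D ->
  (leb R d D < +oo)%E.
Proof.
move=> mD [M [_ MD]]; apply: le_lt_trans (leb_box_fin d (M + 2)).
apply: le_measure; rewrite ?inE//; first exact: measurable_box.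
move=> x Dx i; have /MD/(_ _ Dx) xM : M < M + 1 by rewrite ltrDl.
rewrite -ltr_norml; apply: (@le_lt_trans _ _ (M + 1)); last by lra.
apply: le_trans xM; rewrite [leRHS]mx_normrE.
exact: (le_bigmax _ (fun ij : 'I_1 * 'I_d => `|x ij.1 ij.2|) (ord0, i)).
Qed.

End FiniteMeasure.

(** * Integrals of products of square integrable functions *)

Section RealIntegrals.
Context {d} {T : measurableType d} {R : realType}.
Variables (mu : {measure set T -> \bar R}) (D : set T).
Hypothesis mD : measurable D.
Implicit Types (f g : T -> R).

Lemma ae_dominated_integrable f g : measurable_fun D f ->
  {ae mu, forall x, D x -> `|f x| <= g x} ->
  mu.-integrable D (EFin \o g) -> mu.-integrable D (EFin \o f).
Proof.
move=> mf [N [mN N0 sN]] ig.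
have emf : measurable_fun D (EFin \o f) by exact/measurable_EFinP.
rewrite (negligible_integrable mN)//.
apply: (@le_integrable _ _ _ mu _ _ _ (EFin \o g)); first exact: measurableD.
- by apply: measurable_funS emf => //; exact: subDsetl.
- move=> x [Dx Nx]; rewrite /= lee_fin; apply: (le_trans _ (ler_norm _)).
  by apply: contrapT => nle; apply: Nx; apply: sN => /= /(_ Dx).
- by apply: integrableS ig => //; exact: measurableD.
Qed.

Lemma ae_eq_Rintegral f g : measurable_fun D f -> measurable_fun D g ->
  {ae mu, forall x, D x -> f x = g x} ->
  \int[mu]_(x in D) f x = \int[mu]_(x in D) g x.
Proof.
move=> mf mg fg; rewrite /Rintegral; congr fine; apply: ae_eq_integral => //.
- exact/measurable_EFinP.
- exact/measurable_EFinP.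
- by apply: filterS fg => x fg Dx; rewrite fg.
Qed.

Lemma ae_Rintegral_ge0 f : measurable_fun D f ->
  {ae mu, forall x, D x -> 0 <= f x} -> 0 <= \int[mu]_(x in D) f x.
Proof.
move=> mf f0; rewrite (@ae_eq_Rintegral f (fun x => `|f x|)) ?Rintegral_ge0//.
  exact: measurableT_comp.
by apply: filterS f0 => x f0 Dx; rewrite ger0_norm// f0.
Qed.

Lemma Rintegral_lin c f g : mu.-integrable D (EFin \o f) ->
  mu.-integrable D (EFin \o g) ->
  \int[mu]_(x in D) (c * f x + g x) =
  c * \int[mu]_(x in D) f x + \int[mu]_(x in D) g x.
Proof.
move=> i_f ig; rewrite RintegralD// ?RintegralZl//.
by have := integrableZl mD c i_f; apply: eq_integrable.
Qed.

Lemma integrable_lin c f g : mu.-integrable D (EFin \o f) ->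
  mu.-integrable D (EFin \o g) ->
  mu.-integrable D (EFin \o (fun x => c * f x + g x)).
Proof.
move=> i_f ig; have := integrableD mD (integrableZl mD c i_f) ig.
exact: eq_integrable.
Qed.

End RealIntegrals.

Section SquareIntegrable.
Variables (R : realType) (d : nat) (D : set 'rV[R]_d).
Hypothesis mD : measurable D.
Implicit Types (f g : 'rV[R]_d -> R).

Lemma L2_mul_integrable f g : L2 D f -> L2 D g ->
  (leb R d).-integrable D (EFin \o (fun x => f x * g x)).
Proof.
move=> [mf f2] [mg g2].
have := integrable_lin mD 1 f2 g2.
apply: ae_dominated_integrable => //; first exact: measurable_funM.
apply: aeW => x _; rewrite normrM mul1r.
rewrite -(real_normK (num_real (f x))) -(real_normK (num_real (g x))).
have := sqr_ge0 (`|f x| - `|g x|); have := sqr_ge0 (`|f x| + `|g x|).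
by lra.
Qed.

Lemma L2_lin c f g : L2 D f -> L2 D g -> L2 D (fun x => c * f x + g x).
Proof.
move=> fL gL; have [mf f2] := fL; have [mg g2] := gL.
have mfg : measurable_fun D (fun x => c * f x + g x).
  by apply: measurable_funD => //; exact: measurable_funM.
split => //.
have fg := L2_mul_integrable fL gL.
have := integrable_lin mD (c ^+ 2) f2 (integrable_lin mD (2 * c) fg g2).
apply: eq_integrable => // x _ /=; congr EFin; ring.
Qed.

Lemma L2_bounded_mul f g (M : R) : measurable_fun D g ->
  (forall x, D x -> `|g x| <= M) -> L2 D f -> L2 D (fun x => g x * f x).
Proof.
move=> mg gM [mf f2]; have mgf := measurable_funM mg mf; split => //.
have := integrable_lin mD (M ^+ 2) f2 (integrable0 _ D).
apply: ae_dominated_integrable => //; first exact: measurable_funX.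
apply: aeW => x Dx; rewrite /= addr0 ger0_norm ?sqr_ge0// exprMn ler_wpM2r ?sqr_ge0//.
rewrite -(real_normK (num_real (g x))) ler_sqr ?nnegrE//; first exact: gM.
exact: le_trans (normr_ge0 _) (gM _ Dx).
Qed.

Lemma L2_bounded f (M : R) : (leb R d D < +oo)%E -> measurable_fun D f ->
  (forall x, D x -> `|f x| <= M) -> L2 D f.
Proof.
move=> Dfin mf fM; rewrite (_ : f = fun x => f x * 1); last first.
  by apply/funext => x; rewrite mulr1.
apply: (L2_bounded_mul mf fM); split => //.
apply/integrableP; split => //; rewrite (eq_integral (cst 1%E)).
  by rewrite integral_cst// mul1e.
by move=> x _ /=; rewrite expr1n normr1.
Qed.

Lemma L2S (D' : set 'rV[R]_d) f : measurable D' -> D' `<=` D -> L2 D f -> L2 D' f.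
Proof.
move=> mD' D'D [mf f2]; split; first exact: measurable_funS mf.
exact: integrableS f2.
Qed.

End SquareIntegrable.

(** * The energy form *)

Section CoefficientForm.
Variables (R : realType) (d : nat).
Implicit Types (x y z : 'rV[R]_d) (M : 'M[R]_d).

Definition mxform M x y : R := dotp (M *m x^T)^T y.

Lemma mxformE M x y :
  mxform M x y = \sum_i (\sum_j M i j * x ord0 j) * y ord0 i.
Proof.
rewrite /mxform /dotp; apply: eq_bigr => i _; rewrite !mxE; congr (_ * _).
by apply: eq_bigr => j _; rewrite mxE.
Qed.

Lemma mxform_linl M c x y z :
  mxform M (c *: x + y) z = c * mxform M x z + mxform M y z.
Proof.
rewrite !mxformE mulr_sumr -big_split/=; apply: eq_bigr => i _.
rewrite mulrA -mulrDl mulr_sumr -big_split/=; congr (_ * _).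
by apply: eq_bigr => j _; rewrite !mxE; ring.
Qed.

Lemma mxform_sym M x y : M^T = M -> mxform M x y = mxform M y x.
Proof.
move=> MT; rewrite !mxformE.
under eq_bigr do rewrite mulr_suml.
rewrite exchange_big/=; apply: eq_bigr => i _; rewrite mulr_suml.
apply: eq_bigr => j _; rewrite -{1}MT mxE.
by ring.
Qed.

Lemma dotp_ge0 x : 0 <= dotp x x.
Proof. by apply: sumr_ge0 => i _; rewrite -expr2 sqr_ge0. Qed.

Lemma norm2_sq x : norm2 x ^+ 2 = dotp x x.
Proof. by rewrite sqr_sqrtr// dotp_ge0. Qed.

(** Polarisation: 0 <= M(x + y).(x + y) and 0 <= M(x - y).(x - y) bound the mixed
    term by the diagonal ones.  This is how ellipticity and symmetry bound the
    entries of the coefficient. *)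
Lemma mxform_bound M b : M^T = M ->
  (forall x, 0 <= mxform M x x <= b * dotp x x) ->
  forall x y, `|mxform M x y| <= b * dotp x x + b * dotp y y.
Proof.
move=> MT Mb x y.
have expand c : mxform M (c *: x + y) (c *: x + y) =
    c ^+ 2 * mxform M x x + 2 * c * mxform M x y + mxform M y y.
  rewrite mxform_linl (mxform_sym x _ MT) (mxform_sym y _ MT) !mxform_linl.
  by rewrite (mxform_sym y x MT); ring.
have /andP[plus _] := Mb (1 *: x + y); have /andP[minus _] := Mb ((-1) *: x + y).
have /andP[x0 xb] := Mb x; have /andP[y0 yb] := Mb y.
rewrite !expand in plus minus.
by rewrite ler_norml; apply/andP; split; lra.
Qed.

Definition L2_field (D : set 'rV[R]_d) (F : 'rV[R]_d -> 'rV[R]_d) :=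
  forall i, L2 D (fun x => F x ord0 i).

Section OnDomain.
Variables (A : 'rV[R]_d -> 'M[R]_d) (D : set 'rV[R]_d) (b : R).
Hypothesis mD : measurable D.
Hypothesis mA : forall i j, measurable_fun D (fun x => A x i j).
Hypothesis A_good : {ae leb R d, forall x, D x ->
  (A x)^T = A x /\ forall xi, 0 <= mxform (A x) xi xi <= b * dotp xi xi}.
Implicit Types F G : 'rV[R]_d -> 'rV[R]_d.

Lemma mxform_measurable F G : L2_field D F -> L2_field D G ->
  measurable_fun D (fun x => mxform (A x) (F x) (G x)).
Proof.
move=> LF LG; under eq_fun do rewrite mxformE.
apply: measurable_sum => i; apply: measurable_funM; last by case: (LG i).
apply: measurable_sum => j; apply: measurable_funM => //.
by case: (LF j).
Qed.

Lemma dotp_integrable F : L2_field D F ->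
  (leb R d).-integrable D (EFin \o (fun x => dotp (F x) (F x))).
Proof.
move=> LF.
have := @integrable_sum _ _ _ (leb R d) _ mD _ (index_enum 'I_d) xpredT
  (fun i x => (F x ord0 i * F x ord0 i)%:E).
move=> /(_ (fun i _ => L2_mul_integrable mD (LF i) (LF i))).
by apply: eq_integrable => // x _; rewrite /= /dotp -sumEFin.
Qed.

(** Dominated by b (|F|^2 + |G|^2), almost everywhere only, since ellipticity
    is an almost everywhere property. *)
Lemma mxform_integrable F G : L2_field D F -> L2_field D G ->
  (leb R d).-integrable D (EFin \o (fun x => mxform (A x) (F x) (G x))).
Proof.
move=> LF LG.
have := integrable_lin mD b (dotp_integrable LF)
  (integrable_lin mD b (dotp_integrable LG) (integrable0 _ D)).
apply: ae_dominated_integrable => //; first exact: mxform_measurable.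
apply: filterS A_good => x + Dx => /(_ Dx)[AT Ab]; rewrite addr0.
exact: mxform_bound.
Qed.

Definition form_integral F G : R :=
  \int[leb R d]_(x in D) mxform (A x) (F x) (G x).

Lemma L2_field_lin c F G : L2_field D F -> L2_field D G ->
  L2_field D (fun x => c *: F x + G x).
Proof.
move=> LF LG i; have := L2_lin mD c (LF i) (LG i).
by under [in X in _ -> X]eq_fun do rewrite !mxE.
Qed.

Lemma form_integral_linl c F F' G : L2_field D F -> L2_field D F' ->
  L2_field D G ->
  form_integral (fun x => c *: F x + F' x) G =
  c * form_integral F G + form_integral F' G.
Proof.
move=> LF LF' LG; rewrite -Rintegral_lin//; try exact: mxform_integrable.
by apply: eq_Rintegral => x _; rewrite mxform_linl.
Qed.

Lemma form_integral_sym F G : L2_field D F -> L2_field D G ->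
  form_integral F G = form_integral G F.
Proof.
move=> LF LG; apply: ae_eq_Rintegral => //; try exact: mxform_measurable.
by apply: filterS A_good => x + Dx => /(_ Dx)[AT _]; exact: mxform_sym.
Qed.

Lemma form_integral_ge0 F : L2_field D F -> 0 <= form_integral F F.
Proof.
move=> LF; apply: ae_Rintegral_ge0 => //; first exact: mxform_measurable.
by apply: filterS A_good => x + Dx => /(_ Dx)[_ /(_ (F x))/andP[]].
Qed.

End OnDomain.
End CoefficientForm.

(** * Linearity of the Sobolev and finite element spaces *)

Section LinearSets.
Variables (R : realType) (E : lmodType R).

Definition linear_set (S : set E) : Prop :=
  S 0 /\ forall (c : R) u v, S u -> S v -> S (c *: u + v).

End LinearSets.

Section SobolevLinear.
Variables (R : realType) (d : nat) (D : set 'rV[R]_d).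
Local Notation V := 'rV[R]_d.
Local Notation E := (sobolev_fun R d).
Hypotheses (oD : open D) (bD : bounded_set D).

Let mD : measurable D := open_measurable_rV oD.

Lemma fval_lin (c : R) (u v : E) x :
  fval (c *: u + v) x = c * fval u x + fval v x.
Proof. by []. Qed.

Lemma fgrad_lin (c : R) (u v : E) x :
  fgrad (c *: u + v) x = c *: fgrad u x + fgrad v x.
Proof. by []. Qed.

(** A bounded set lies in a closed ball, which is compact. *)
Lemma continuous_bounded_on (f : V -> R) : continuous f ->
  exists M, forall x, D x -> `|f x| <= M.
Proof.
move=> cf; have [M [_ MD]] := bD.
have DM x : D x -> `|x| <= M + 1 by apply: MD; rewrite ltrDl.
pose K := [set x : V | `|x| <= M + 1].
have cK : compact K.
  apply: bounded_closed_compact.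
    by exists (M + 1); split; [exact: num_real|move=> t Mt x /le_trans; apply; exact: ltW].
  apply: (@preimage_closed _ _ (fun x : V => `|x|) [set y | y <= M + 1]).
    by move=> x _; exact: norm_continuous.
  exact: closed_le.
have [N [_ NK]] : bounded_set (f @` K).
  apply: compact_bounded; apply: continuous_compact => //.
  by apply: continuous_subspaceT.
exists (N + 1) => x Dx; apply: (NK (N + 1)); first by rewrite ltrDl.
by exists x => //; exact: DM.
Qed.

Lemma continuous_L2 (f : V -> R) : continuous f -> L2 D f.
Proof.
move=> cf; have [M fM] := continuous_bounded_on cf.
apply: (L2_bounded mD _ _ fM); first exact: leb_bounded_fin.
by apply: continuous_open_measurable_fun => // x _; exact: cf.
Qed.

Lemma test_function_L2 phi i : test_function D phi ->
  L2 D phi /\ L2 D (partial i phi).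
Proof.
move=> [/(_ 1%N)[cphi /(_ i)[_ [cp _]]] _].
by split; exact: continuous_L2.
Qed.

Lemma L2_0 : L2 D (fun=> 0).
Proof. by apply: continuous_L2; exact: (@cst_continuous _ _ (0 : R)). Qed.

(** The defining identity of the weak gradient is linear in the pair because
    each of its integrals converges: test functions and their derivatives are
    square integrable on the bounded set D. *)
Lemma H1_linear : linear_set (H1 D).
Proof.
split.
  split; [exact: L2_0|by move=> i; under eq_fun do rewrite mxE; exact: L2_0|].
  move=> phi _ i; under eq_Rintegral do rewrite mul0r.
  under [in RHS]eq_Rintegral do rewrite mxE mul0r.
  by rewrite Rintegral_cst// mul0r oppr0.
move=> c u v [Lu Lgu wu] [Lv Lgv wv]; split.
- exact: (L2_lin mD c Lu Lv).
- exact: L2_field_lin.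
move=> phi tphi i; have [Lphi Lp] := test_function_L2 i tphi.
have eqL : \int[leb R d]_(x in D) (fval (c *: u + v) x * partial i phi x) =
    c * \int[leb R d]_(x in D) (fval u x * partial i phi x) +
    \int[leb R d]_(x in D) (fval v x * partial i phi x).
  rewrite -Rintegral_lin//; try exact: L2_mul_integrable.
  by apply: eq_Rintegral => x _; rewrite fval_lin; ring.
have eqR : \int[leb R d]_(x in D) (fgrad (c *: u + v) x ord0 i * phi x) =
    c * \int[leb R d]_(x in D) (fgrad u x ord0 i * phi x) +
    \int[leb R d]_(x in D) (fgrad v x ord0 i * phi x).
  rewrite -Rintegral_lin//; try exact: L2_mul_integrable.
  by apply: eq_Rintegral => x _; rewrite fgrad_lin !mxE; ring.
by rewrite eqL eqR wu// wv//; ring.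
Qed.

Lemma H1_field u : H1 D u -> L2_field D (fgrad u). Proof. by case. Qed.

Lemma H1_normsq_integrable u : H1 D u -> (leb R d).-integrable D
  (EFin \o (fun x => fval u x ^+ 2 + dotp (fgrad u x) (fgrad u x))).
Proof.
move=> [[_ u2] Lg _].
have := integrable_lin mD 1 u2 (dotp_integrable mD Lg).
by apply: eq_integrable => // x _ /=; rewrite mul1r.
Qed.

Lemma H1_normsq0 : H1_normsq D 0 = 0.
Proof.
rewrite /H1_normsq; under eq_Rintegral.
  move=> x _; rewrite expr0n/= /dotp big1 ?addr0; last by move=> i _; rewrite mxE mul0r.
  over.
by rewrite Rintegral_cst// mul0r.
Qed.

Lemma H1_normsq_lin c u v : H1 D u -> H1 D v ->
  H1_normsq D (c *: u + v) <= 2 * c ^+ 2 * H1_normsq D u + 2 * H1_normsq D v.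
Proof.
move=> Hu Hv; have Huv := H1_linear.2 c u v Hu Hv.
have iu := H1_normsq_integrable Hu; have iv := H1_normsq_integrable Hv.
have i2v : (leb R d).-integrable D
    (EFin \o (fun x => 2 * (fval v x ^+ 2 + dotp (fgrad v x) (fgrad v x)))).
  by have := integrableZl mD 2 iv; apply: eq_integrable.
rewrite /H1_normsq -[X in _ <= _ + X]RintegralZl// -Rintegral_lin//.
apply: le_Rintegral => //; first exact: H1_normsq_integrable.
  exact: integrable_lin.
move=> x _; rewrite fval_lin fgrad_lin.
have sq (p q : R) : (c * p + q) ^+ 2 <= 2 * c ^+ 2 * p ^+ 2 + 2 * q ^+ 2.
  by have := sqr_ge0 (c * p - q); lra.
have : dotp (c *: fgrad u x + fgrad v x) (c *: fgrad u x + fgrad v x) <=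
    2 * c ^+ 2 * dotp (fgrad u x) (fgrad u x) + 2 * dotp (fgrad v x) (fgrad v x).
  rewrite /dotp !mulr_sumr -big_split/=; apply: ler_sum => i _.
  by rewrite !mxE -!expr2.
by have := sq (fval u x) (fval v x); lra.
Qed.

(** Approximants of u and v are combined linearly, and vanish on the
    intersection of the two neighbourhoods of G. *)
Lemma H1_zero_linear G : linear_set (H1_zero D G).
Proof.
split.
  split; first exact: H1_linear.1.
  move=> e e0; exists 0; first exact: H1_linear.1.
  split; last by rewrite subrr H1_normsq0.
  by exists setT; split => //; [exact: openT|exact: aeW].
move=> c u v [Hu au] [Hv av]; split; first exact: H1_linear.2.
move=> e e0.
have c1 : 0 < c ^+ 2 + 1 by have := sqr_ge0 c; lra.
(* By [H1_normsq_lin] the first error is multiplied by 2 c^2, the second one by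
   2; each contribution is to stay within e / 2. *)
have e1 : 0 < e / 4 / (c ^+ 2 + 1) by rewrite !divr_gt0.
have e2 : 0 < e / 4 by rewrite divr_gt0.
have [p Hp [[U [oU GU pU]] up]] := au _ e1.
have [q Hq [[U' [oU' GU' qU']] vq]] := av _ e2.
exists (c *: p + q); first exact: H1_linear.2.
split.
  exists (U `&` U'); split; [exact: openI|by move=> x Gx; split; [exact: GU|exact: GU']|].
  apply: filterS2 pU qU' => x pU qU' Dx [Ux Ux'].
  by rewrite fval_lin pU// qU'// mulr0 addr0.
have -> : c *: u + v - (c *: p + q) = c *: (u - p) + (v - q).
  by rewrite scalerBr opprD addrACA.
have Hd u' p' : H1 D u' -> H1 D p' -> H1 D (u' - p').
  by move=> Hu' Hp'; rewrite -scaleN1r addrC; exact: H1_linear.2.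
apply: le_lt_trans (H1_normsq_lin c (Hd _ _ Hu Hp) (Hd _ _ Hv Hq)) _.
have : 2 * c ^+ 2 * H1_normsq D (u - p) <= 2 * c ^+ 2 * (e / 4 / (c ^+ 2 + 1)).
  by apply: ler_wpM2l; [rewrite mulr_ge0// sqr_ge0|exact: ltW].
have : 2 * c ^+ 2 * (e / 4 / (c ^+ 2 + 1)) <= e / 2.
  rewrite (_ : _ * _ = e / 2 * (c ^+ 2 / (c ^+ 2 + 1))); last first.
    by field; rewrite gt_eqF.
  by rewrite ger_pMr ?divr_gt0// ler_pdivrMr// mul1r; lra.
lra.
Qed.

End SobolevLinear.

(** * The spaces of the local problem *)

Section LocalSpaces.
Variables (R : realType) (d : nat) (P : local_problem R d).
Local Notation V := 'rV[R]_d.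
Local Notation E := (sobolev_fun R d).

Lemma bounded_subset (D D' : set V) : D `<=` D' -> bounded_set D' -> bounded_set D.
Proof. by move=> DD' [M [rM bM]]; exists M; split => // N MN x /DD'; exact: bM. Qed.

Lemma omegas_Omega : omegas P `<=` Omega P.
Proof. by move=> x; exact: omegas_sub. Qed.

Lemma omega_omegas : omega P `<=` omegas P.
Proof. by move=> x; exact: omega_sub. Qed.

Lemma omega_Omega : omega P `<=` Omega P.
Proof. exact: subset_trans omega_omegas omegas_Omega. Qed.

Lemma omegas_open : open (omegas P). Proof. by case: (omegas_domain P). Qed.
Lemma omega_open : open (omega P). Proof. by case: (omega_domain P). Qed.

Lemma omegas_bounded : bounded_set (omegas P).
Proof. exact: (bounded_subset omegas_Omega (Omega_bounded P)). Qed.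

Lemma omega_bounded : bounded_set (omega P).
Proof. exact: (bounded_subset omega_omegas omegas_bounded). Qed.

Let mos : measurable (omegas P) := open_measurable_rV omegas_open.
Let mo : measurable (omega P) := open_measurable_rV omega_open.

Lemma coefA_measurable_on (D : set V) i j : D `<=` Omega P ->
  measurable_fun D (fun x => coefA P x i j).
Proof.
move=> DO; apply: measurable_funS (coefA_measurable i j) => //.
by apply: open_measurable_rV; case: (Omega_domain P).
Qed.

Lemma coefA_good_on (D : set V) : D `<=` Omega P -> {ae leb R d, forall x, D x ->
  (coefA P x)^T = coefA P x /\
  forall xi, 0 <= mxform (coefA P x) xi xi <= beta P * dotp xi xi}.
Proof.
move=> DO; apply: filterS (coefA_elliptic P) => x + /DO => /[apply] -[AT Ab].
split => // xi; have := Ab xi; rewrite -/(mxform _ _ _) norm2_sq => /andP[lo ->].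
rewrite andbT; apply: le_trans lo; apply: mulr_ge0; last exact: dotp_ge0.
by have /andP[/ltW] := alpha_beta P.
Qed.

(** Integrability, symmetry and sign of the energy density hold almost
    everywhere on omegas, hence the form is a semi-inner product on every linear
    subspace of H1 (omegas). *)
Lemma a_omegas_semi_inner (S : set E) : linear_set S -> S `<=` H1 (omegas P) ->
  semi_inner (a_omegas P) S.
Proof.
move=> [S0 Sl] SH; have mA i j := @coefA_measurable_on (omegas P) i j omegas_Omega.
have good := coefA_good_on omegas_Omega.
have LS u : S u -> L2_field (omegas P) (fgrad u) by move=> /SH; exact: H1_field.
split => //.
- by move=> u v /LS Lu /LS Lv; exact: (form_integral_sym mos mA good).
- by move=> c u v w /LS Lu /LS Lv /LS Lw; exact: (form_integral_linl mos mA good).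
- by move=> u /LS Lu; exact: (form_integral_ge0 mos mA good).
Qed.

Let H1_omegas_linear := H1_linear omegas_open omegas_bounded.

Lemma a_omegas_orth_linear (S S' : set E) : linear_set S ->
  S `<=` H1 (omegas P) -> S' `<=` H1 (omegas P) ->
  linear_set [set u | S u /\ forall v, S' v -> a_omegas P u v = 0].
Proof.
move=> Slin SH S'H; have [S0 Sl] := Slin.
have aH := a_omegas_semi_inner H1_omegas_linear (@subset_refl _ _).
split; first by split => // v /S'H; exact: (si_0l aH).
move=> c u v [Su au] [Sv av]; split; first exact: Sl.
move=> w S'w; rewrite (si_linl aH) ?au ?av ?mulr0 ?addr0//; try exact: SH.
exact: S'H.
Qed.

Lemma gradient_chi_bounded i x : omega P x ->
  `|gradient (chi P) x ord0 i| <= C1 P / diam (omega P).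
Proof.
move=> ox; apply: le_trans (chi_gradient ox).
rewrite -[leLHS]ger0_norm ?normr_ge0// -ler_sqr ?nnegrE// ?sqrtr_ge0//.
rewrite norm2_sq normr_id real_normK ?num_real// /dotp (bigD1 i)//= -expr2 lerDl.
by apply: sumr_ge0 => j _; rewrite -expr2 sqr_ge0.
Qed.

(** A bounded measurable field on a set of finite measure. *)
Lemma gradient_chi_field : L2_field (omega P) (gradient (chi P)).
Proof.
have [_ cpart] := chi_C1 P.
move=> i; apply: (@L2_bounded _ _ _ mo _ (C1 P / diam (omega P))).
- exact: (leb_bounded_fin mo omega_bounded).
- apply: (continuous_open_measurable_fun omega_open).
  rewrite -(continuous_open_subspace _ omega_open).
  rewrite (_ : (fun x => _) = partial i (chi P)); first exact: cpart.
  by apply/funext => x; rewrite mxE.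
- exact: gradient_chi_bounded.
Qed.

Lemma chi_measurable : measurable_fun (omega P) (chi P).
Proof.
have [dchi _] := chi_C1 P; apply: (continuous_open_measurable_fun omega_open).
by move=> x; rewrite inE => /dchi /differentiable_continuous.
Qed.

Lemma cutoff_field u : H1 (omegas P) u ->
  L2_field (omega P) (fgrad (cutoff (chi P) u)).
Proof.
move=> [Lu Lg _] i.
have Lu' := L2S mos mo omega_omegas Lu.
have Lg' := L2S mos mo omega_omegas (Lg i).
have [mG _] := gradient_chi_field i.
have LuG := L2_bounded_mul mo mG (gradient_chi_bounded i) Lu'.
have chi1 x : omega P x -> `|chi P x| <= 1.
  by move=> _; have /andP[c0 c1] := chi_range P x; rewrite ger0_norm.
have := L2_lin mo 1 LuG (L2_bounded_mul mo chi_measurable chi1 Lg').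
rewrite (_ : (fun x => 1 * _ + _) = (fun x => fgrad (cutoff (chi P) u) x ord0 i))//.
by apply/funext => x; rewrite !mxE mul1r mulrC.
Qed.

(** Momega is the energy pairing of the gradient of chi u, which depends linearly
    on u, with the fixed square integrable field grad chi. *)
Lemma Momega_lin (c : R) (u v : E) : H1 (omegas P) u -> H1 (omegas P) v ->
  Momega P (c *: u + v) = c * Momega P u + Momega P v.
Proof.
move=> Hu Hv; have Lu := cutoff_field Hu; have Lv := cutoff_field Hv.
have mA i j := @coefA_measurable_on (omega P) i j omega_Omega.
have good := coefA_good_on omega_Omega.
have <- := form_integral_linl mo mA good c Lu Lv gradient_chi_field.
apply: eq_Rintegral => x _; congr (mxform _ _ _).
rewrite -[LHS]/(fval (c *: u + v) x *: gradient (chi P) x +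
  chi P x *: fgrad (c *: u + v) x).
rewrite -[RHS]/(c *: (fval u x *: gradient (chi P) x + chi P x *: fgrad u x) +
  (fval v x *: gradient (chi P) x + chi P x *: fgrad v x)).
rewrite fval_lin fgrad_lin !scalerDl !scalerDr !scalerA.
by rewrite addrACA [c * chi P x]mulrC.
Qed.

Lemma Momega_kernel_linear (Q : Prop) (S : set E) : linear_set S ->
  S `<=` H1 (omegas P) -> linear_set [set u | S u /\ (Q -> Momega P u = 0)].
Proof.
move=> [S0 Sl] SH; split.
  split=> // _; have := Momega_lin 1 (SH _ S0) (SH _ S0).
  by rewrite scaler0 addr0 mul1r => /eqP; rewrite addrC -subr_eq subrr => /eqP.
move=> c u v [Su Mu] [Sv Mv]; split=> [|q]; first exact: Sl.
by rewrite Momega_lin ?Mu ?Mv ?mulr0 ?addr0//; exact: SH.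
Qed.

Lemma ref_polynomial_lin k (c : R) (p q : V -> R) :
  ref_polynomial k p -> ref_polynomial k q ->
  ref_polynomial k (fun x => c * p x + q x).
Proof.
move=> [cp [cp0 pE]] [cq [cq0 qE]]; exists (fun S => c * cp S + cq S); split.
  by move=> kS S S1; rewrite cp0// cq0// mulr0 addr0.
move=> t; rewrite pE qE mulr_sumr -big_split/=; apply: eq_bigr => S _.
by rewrite mulrDl mulrA.
Qed.

Lemma lagrange_space_lin k (tau : seq (cell R d)) (D : set V) (c : R) v w :
  lagrange_space k tau D v -> lagrange_space k tau D w ->
  lagrange_space k tau D (fun x => c * v x + w x).
Proof.
move=> [cv vp] [cw wp]; split.
  move=> x; apply: cvgD; last exact: cw.
  by apply: cvgMl_tmp; exact: cv.
move=> K Kt; have [p pp pv] := vp K Kt; have [q qq qw] := wp K Kt.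
exists (fun t => c * p t + q t); first exact: ref_polynomial_lin.
by move=> t rt; rewrite pv// qw.
Qed.

Lemma lagrange_space0 k (tau : seq (cell R d)) (D : set V) :
  lagrange_space k tau D (fun=> 0).
Proof.
split; first by move=> x; exact: cvg_cst.
move=> K _; exists (fun=> 0) => //; exists (fun=> 0); split => // t.
by rewrite big1// => S _; rewrite mul0r.
Qed.

Lemma Vh_zero_linear h G : linear_set (Vh_zero P h G).
Proof.
split.
  split; first exact: H1_omegas_linear.1.
  exists (fun=> 0); first exact: lagrange_space0.
  by split => //; exact: aeW.
move=> c u v [Hu [u' Lu [uu' u'0]]] [Hv [v' Lv [vv' v'0]]].
split; first exact: H1_omegas_linear.2.
exists (fun x => c * u' x + v' x); first exact: lagrange_space_lin.
split; last by move=> x Gx; rewrite u'0// v'0// mulr0 addr0.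
by apply: filterS2 uu' vv' => x ux vx ox; rewrite fval_lin ux// vx.
Qed.

Lemma H_AD_H1 : H_AD P `<=` H1 (omegas P). Proof. by move=> u [[]]. Qed.

Lemma Wh_AD_H1 h : Wh_AD P h `<=` H1 (omegas P). Proof. by move=> u [[]]. Qed.

Lemma Hspace_semi_inner : semi_inner (a_omegas P) (Hspace P).
Proof.
apply: a_omegas_semi_inner; last by move=> u [/H_AD_H1].
apply: Momega_kernel_linear; last exact: H_AD_H1.
apply: a_omegas_orth_linear; [|by move=> u []..].
exact: (H1_zero_linear omegas_open omegas_bounded).
Qed.

Lemma Whspace_semi_inner h : semi_inner (a_omegas P) (Whspace P h).
Proof.
apply: a_omegas_semi_inner; last by move=> u [/Wh_AD_H1].
apply: Momega_kernel_linear; last exact: Wh_AD_H1.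
apply: a_omegas_orth_linear; [exact: Vh_zero_linear|by move=> u []..].
Qed.

End LocalSpaces.

Theorem theorem4p2 (R : realType) (d : nat) (hd : d = 2%N \/ d = 3%N)
  (P : local_problem R d)
  (T : sobolev_fun R d -> sobolev_fun R d)
  (Th : R -> sobolev_fun R d -> sobolev_fun R d)
  (Rh : R -> sobolev_fun R d -> sobolev_fun R d)
  (mu : nat -> R) (muh : R -> nat -> R) :
  let a := a_omegas P in
  let H := Hspace P in
  let W := Whspace P in
  represents_b_chi P H T ->
  (forall h, 0 < h <= 1 -> represents_b_chi P (W h) (Th h)) ->
  eigenvalue_sequence a H T mu ->
  (forall h, 0 < h <= 1 -> eigenvalue_sequence a (W h) (Th h) (muh h)) ->
  (* I *)
  (forall h, 0 < h <= 1 -> maps H (W h) (Rh h) /\ linear_op a H (Rh h)) ->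
  (exists c0, forall h, 0 < h <= 1 -> bounded_op a H c0 (Rh h)) ->
  (forall (uh vh : R -> sobolev_fun R d) u v,
    (forall h, 0 < h <= 1 -> W h (uh h) /\ W h (vh h)) -> H u -> H v ->
    anorm a (uh h - Rh h u) @[h --> 0^'+] --> (0 : R) ->
    anorm a (vh h - Rh h v) @[h --> 0^'+] --> (0 : R) ->
    a (uh h) (vh h) @[h --> 0^'+] --> a u v) ->
  (* II *)
  [/\ positive_op a H T, compact_op a H T & selfadjoint_op a H T] ->
  (forall h, 0 < h <= 1 ->
    [/\ positive_op a (W h) (Th h), compact_op a (W h) (Th h) &
        selfadjoint_op a (W h) (Th h)]) ->
  (exists C, forall h, 0 < h <= 1 -> bounded_op a (W h) C (Th h)) ->
  (* III *)
  (forall (psih : R -> sobolev_fun R d) psi,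
    (forall h, 0 < h <= 1 -> W h (psih h)) -> H psi ->
    anorm a (psih h - Rh h psi) @[h --> 0^'+] --> (0 : R) ->
    anorm a (Th h (psih h) - Rh h (T psi)) @[h --> 0^'+] --> (0 : R)) ->
  (* IV *)
  (forall (hs : nat -> R) (psi : nat -> sobolev_fun R d),
    (forall n, 0 < hs n <= 1) -> hs n @[n --> \oo] --> (0 : R) ->
    (forall n, W (hs n) (psi n)) -> (exists C, forall n, anorm a (psi n) <= C) ->
    exists2 s, increasing_index s &
    exists2 u, H u &
      anorm a (Th (hs (s n)) (psi (s n)) - Rh (hs (s n)) u)
        @[n --> \oo] --> (0 : R)) ->
  forall k, 0 < mu k ->
    muh h k @[h --> 0^'+] --> mu k /\
    \forall h \near 0^'+,
      `|muh h k - mu k| <=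
        2 * sup [set r | exists u,
          [/\ eigen_space a H T (mu k) u, anorm a u = 1 &
              r = anorm a (Th h (Rh h u) - Rh h (T u))]].
Proof.
move=> a H W [Tm _] ThR mu_eig muh_eig Rlin Rbd inner_cvg [Tpos Tcpt Tsa] ThP Th_bd
  Th_cvg Th_cpt k mu_gt0.
have aH : semi_inner a H := Hspace_semi_inner P.
have aW h : 0 < h <= 1 -> semi_inner a (W h).
  by move=> _; exact: Whspace_semi_inner.
have TH : compact_positive_op a H T by [].
have ThW h : 0 < h <= 1 -> compact_positive_op a (W h) (Th h).
  by move=> h01; have [Th_maps _] := ThR h h01; have [] := ThP h h01.
split.
  exact: (muh_cvg aH aW TH ThW mu_eig muh_eig Rlin inner_cvg Th_cvg Th_cpt).
exact: (muh_error aH aW TH ThW mu_eig muh_eig Rlin Rbd inner_cvg Th_bd Th_cvg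
  Th_cpt mu_gt0).
Qed.
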